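(* Let $p\ge0$ be an integer and $c\in\mathbb{R}$ such that $\mathbf M+\mathbf K$ is invertible. Let $q_j$ ($0\le j\le p$) be the $j$th diagonal entry of $(\mathbf M+\mathbf K)^{-1}$ in the Legendre basis and let $$P(z):=2^{-(p+1)}z^{p+1}-\sum_{j,k=0}^p(-1)^j2^{k-p}q_j\,\psi_j^{(k)}(-1)\,z^{p-k},\qquad Q(z):=-\sum_{j,k=0}^p(-1)^j2^{k-p}q_j\,\psi_j^{(k)}(1)\,z^{p-k}.$$ Then the rational function $P(z)/Q(z)$ is a superconvergent approximant of $e^{-z}$, namely $$P(z)-Q(z)e^{-z}=\frac{1}{2^{p+1}}z^{p+1}e^{-z/2}\left(e^{z/2}-\sum_{j=0}^p2q_jI_j(z/2)\right)$$ and, as $z\to0$, $$P(z)-Q(z)e^{-z}=\frac{1}{2^{p+1}}\left(b_1(p,c)z^{2p+1}+b_2(p,c)z^{2p+2}\right)+O(z^{2p+3}),$$ where $$b_1(p,c):=\frac{(1-f(c))\,p!}{(2p)!},\qquad b_2(p,c):=\frac{(f(c)-1)\,p!}{2(2p)!}+\frac{(p+1)!}{(2p+2)!},\qquad f(c):=\frac{1}{1+c\,\frac{(2p+1)((2p)!)^2}{2^{2p+1}(p!)^2}},$$ and $I_j$ is the $j$th modified spherical Bessel function of the first kind.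
   Context: $\psi_j$ is the standard Legendre polynomial of degree $j$ (with $\psi_j(1)=1$), and $\psi_j^{(k)}$ its $k$th derivative. In the Legendre basis $\psi_0,\dots,\psi_p$ of the polynomials of degree at most $p$ on $[-1,1]$, let $\mathbf D$ be the matrix of $d/d\xi$ acting on coefficient vectors, $\mathbf M_{mn}=\int_{-1}^1\psi_m\psi_n\,d\xi$, and $\mathbf K=\tfrac12c\,(\mathbf D^p)^T\mathbf M\mathbf D^p$, where $c$ is the ESFR scalar parameter; $\mathbf M+\mathbf K$ is diagonal. The variable $z$ is complex. The modified spherical Bessel function of the first kind is $$I_j(z)=\frac{\sqrt\pi}{2}\sum_{k=0}^\infty\frac{(z/2)^{2k+j}}{k!\,\Gamma(k+j+\tfrac32)}.$$ *)

(* Defs.v *)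
From HB Require Import structures.
From mathcomp Require Import all_boot all_order all_algebra.
From mathcomp Require Import all_classical all_reals all_analysis.
From mathcomp Require Import complex.

Set Implicit Arguments.
Unset Strict Implicit.
Unset Printing Implicit Defensive.

Import Order.TTheory GRing.Theory Num.Theory.
Import numFieldNormedType.Exports.

Local Open Scope classical_set_scope.
Local Open Scope ring_scope.
Local Open Scope complex_scope.

Section Legendre.
Variable R : realType.

(* Rodrigues' formula; the normalization is (legendre n).[1] = 1. *)
Definition legendre (n : nat) : {poly R} :=
  (2 ^+ n * n`!%:R)^-1 *: (('X^2 - 1) ^+ n)^`(n).

(* The family psi_0, ..., psi_p in the space of polynomials of size <= p + 1,
   i.e. of degree <= p, where npolyp is the identity. *)
Definition legendre_basis (p : nat) : (p.+1).-tuple {poly_p.+1 R} :=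
  [tuple npolyp p.+1 (legendre i) | i < p.+1].

(* Column n holds the coordinates of psi_n', so that D acts on column
   vectors of coefficients. *)
Definition diff_mx (p : nat) : 'M[R]_p.+1 :=
  \matrix_(m, n) coord (legendre_basis p) m (npolyp p.+1 (legendre n)^`()).

Definition mass_mx (p : nat) : 'M[R]_p.+1 :=
  \matrix_(m, n)
    \int[lebesgue_measure]_(x in `[(-1 : R), 1])
      ((legendre m).[x] * (legendre n).[x]).

Definition esfr_mx (p : nat) (c : R) : 'M[R]_p.+1 :=
  (c / 2) *: ((diff_mx p ^+ p)^T *m mass_mx p *m diff_mx p ^+ p).

Definition esfr_q (p : nat) (c : R) (j : 'I_p.+1) : R :=
  invmx (mass_mx p + esfr_mx p c) j j.

End Legendre.

Section Functions.
Variable R : realType.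

(* Euler's integral, used for positive real x only. *)
Definition Gamma (x : R) : R :=
  \int[lebesgue_measure]_(t in `]0, +oo[) (t `^ (x - 1) * expR (- t)).

Definition cexp (z : R[i]) : R[i] :=
  let: x +i* y := z in (expR x)%:C * (cos y +i* sin y).

(* R[i]^o is R[i] seen as a normed space over itself, which supplies the
   topology for the limit. *)
Definition sph_besselI (j : nat) (z : R[i]) : R[i] :=
  (Num.sqrt pi / 2)%:C *
  limn (series (fun k : nat =>
    (z / 2) ^+ (2 * k + j) /
      (k`!%:R * Gamma (k%:R + j%:R + 3 / 2))%:C : R[i]^o)).

End Functions.

Section Approximant.
Variables (R : realType) (p : nat) (c : R).

Definition P_poly : {poly R[i]} :=
  (2 ^+ p.+1)^-1 *: 'X^(p.+1) -
  \sum_(j < p.+1) \sum_(k < p.+1)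
    ((-1) ^+ j * 2 ^ (k%:Z - p%:Z) * esfr_q c j
       * ((legendre R j)^`(k)).[-1])%:C *: 'X^(p - k).

Definition Q_poly : {poly R[i]} :=
  - \sum_(j < p.+1) \sum_(k < p.+1)
    ((-1) ^+ j * 2 ^ (k%:Z - p%:Z) * esfr_q c j
       * ((legendre R j)^`(k)).[1])%:C *: 'X^(p - k).

Definition f_corr : R :=
  (1 + c * (((2 * p).+1)%:R * ((2 * p)`!%:R) ^+ 2
              / (2 ^+ (2 * p).+1 * (p`!%:R) ^+ 2)))^-1.

Definition b1 : R := (1 - f_corr) * p`!%:R / (2 * p)`!%:R.

Definition b2 : R :=
  (f_corr - 1) * p`!%:R / (2 * (2 * p)`!%:R)
  + (p.+1)`!%:R / ((2 * p).+2)`!%:R.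

End Approximant.

(* Main.v *)
Require Import Defs.
From HB Require Import structures.
From mathcomp Require Import all_boot all_order all_algebra.
From mathcomp Require Import all_classical all_reals all_analysis.
From mathcomp Require Import complex ring.

Set Implicit Arguments.
Unset Strict Implicit.
Unset Printing Implicit Defensive.

Import Order.TTheory GRing.Theory Num.Theory.
Import numFieldNormedType.Exports.

Local Open Scope classical_set_scope.
Local Open Scope ring_scope.
Local Open Scope complex_scope.

(** Integrating by parts repeatedly, the integral of [psi_j(t) e^(wt)] over
[-1, 1] is [w^-(p+1)] times a combination of [e^w] and [e^-w] with polynomial
coefficients; its Taylor coefficients are the moments of [psi_j], which
Rodrigues' formula evaluates as those of [2 I_j].  With [w = z / 2], summing
against [q_j] and using the parity of [psi_j] turns [P - Q e^-z] into
[e^-w w^(p+1) (e^w - sum_j 2 q_j I_j(w))].  Since [M + K] is diagonal,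
[q_j = (2j + 1) / 2] for [j < p], whereas [q_p] carries the extra factor [f(c)].
Expanding [t^m] in Legendre polynomials and evaluating at [t = 1] then shows
that the coefficient of [w^m] in [e^w - sum_j 2 q_j I_j(w)] vanishes for
[m < p] and gives its values for [m = p] and [m = p + 1]. *)

(** * Legendre polynomials *)

(** The Bessel series is never estimated directly. Its partial sums form a subsequence of those of a
    finite combination of exponentials, so convergence, value and expansion at 0 all come from one
    Taylor bound for [cexp]. [Gamma] is an integral, but it is met only at half-integers, where an
    explicit antiderivative evaluates it. Keeping the factor w^(p+1) in front avoids division by w,
    so the identity also holds at z = 0. The parameter c enters only through q_p because the p-th
    derivative kills psi_n for n < p and makes psi_p constant: D^p, hence K, has a single nonzero
    entry. In b_2 the summand free of c comes from psi_(p+1), since parity removes psi_p at order p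
    + 1; the other summand is -b_1/2 and comes from the term -w of e^-w. *)

Section PolyIntegral.
Variable R : realType.
Implicit Types p q : {poly R}.

Definition pint p : R := \int[lebesgue_measure]_(x in `[(-1 : R), 1]) p.[x].

Lemma pint_integrable p :
  (@lebesgue_measure R).-integrable `[(-1 : R), 1] (EFin \o (fun x => p.[x])).
Proof.
apply: continuous_compact_integrable; first exact: segment_compact.
by apply: continuous_subspaceT => x; exact: continuous_horner.
Qed.

Lemma pint_is_linear : scalar pint.
Proof.
move=> a p q; rewrite /pint.
under eq_Rintegral do rewrite hornerD hornerZ.
rewrite RintegralD //; last 2 first.
- rewrite (_ : _ \o _ = EFin \o (fun x => (a *: p).[x])); last first.
    by apply/funext => x /=; rewrite hornerZ.
  exact: pint_integrable.
- exact: pint_integrable.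
by rewrite RintegralZl //; exact: pint_integrable.
Qed.

HB.instance Definition _ :=
  GRing.isLinear.Build R {poly R} R _ pint pint_is_linear.

Lemma pintZr a p q : pint (p * (a *: q)) = a * pint (p * q).
Proof. by rewrite -scalerAr linearZ. Qed.

Lemma pint_deriv p : pint p^`() = p.[1] - p.[-1].
Proof.
rewrite /pint /Rintegral (@continuous_FTC2 _ _ (fun x => p.[x])) //.
- by apply: continuous_subspaceT => x; exact: continuous_horner.
- split.
  + by move=> x _; exact: derivable_horner.
  + by apply: cvg_at_right_filter; exact: continuous_horner.
  + by apply: cvg_at_left_filter; exact: continuous_horner.
- by move=> x _; rewrite derivE.
Qed.


Lemma pint_byparts p q :
  pint (p^`() * q) = p.[1] * q.[1] - p.[-1] * q.[-1] - pint (p * q^`()).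
Proof.
have := pint_deriv (p * q); rewrite derivM linearD !hornerM => <-.
by rewrite addrK.
Qed.

Lemma pint_bypartsn p q n :
  (forall i, (i < n)%N -> p^`(i).[1] = 0 /\ p^`(i).[-1] = 0) ->
  pint (p^`(n) * q) = (-1) ^+ n * pint (p * q^`(n)).
Proof.
elim: n q => [|n IH] q hp; first by rewrite expr0 mul1r.
have [h1 h2] := hp n (ltnSn n).
rewrite derivnS pint_byparts h1 h2 !mul0r subrr sub0r IH; last first.
  by move=> i /ltnW; exact: hp.
by rewrite exprS mulN1r mulNr derivSn.
Qed.

End PolyIntegral.

(** * Repeated derivatives at a multiple root *)

Section RootDerivatives.
Variable R : comNzRingType.
Implicit Types (a : R) (q : {poly R}).

(** The derivative is again a power of ['X - a%:P] times a polynomial, with exponent one less. Since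
    [q] is arbitrary in the next two lemmas, their inductions can absorb the new cofactor. *)
Lemma deriv_XsubC_exp_mul a q n :
  (('X - a%:P) ^+ n.+1 * q)^`() =
  ('X - a%:P) ^+ n * (q *+ n.+1 + ('X - a%:P) * q^`()).
Proof.
rewrite derivM deriv_exp derivXsubC mul1r /= mulrDr mulrA -exprSr.
by rewrite mulrnAl mulrnAr.
Qed.

Lemma derivn_XsubC_exp_lt a q n i : (i < n)%N ->
  (('X - a%:P) ^+ n * q)^`(i).[a] = 0.
Proof.
elim: i n q => [|i IH] [|n] q // hi.
  by rewrite derivn0 exprS -mulrA mulrC hornerM hornerXsubC subrr mulr0.
by rewrite derivSn deriv_XsubC_exp_mul IH.
Qed.

Lemma derivn_XsubC_exp a q n :
  (('X - a%:P) ^+ n * q)^`(n).[a] = n`!%:R * q.[a].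
Proof.
elim: n q => [|n IH] q; first by rewrite expr0 !mul1r.
rewrite derivSn deriv_XsubC_exp_mul IH !hornerE subrr mul0r addr0.
by rewrite hornerMn factS mulnC natrM -mulrA (mulr_natl _ n.+1).
Qed.

End RootDerivatives.

Section Legendre.
Variable R : realType.
Implicit Types p q : {poly R}.
Local Notation psi := (legendre R).
Local Notation u := ('X^2 - 1 : {poly R}).

Lemma X2sub1E : u = ('X - 1%:P) * ('X - (-1)%:P).
Proof. rewrite polyCN; ring. Qed.

(** At 1 all n derivatives must fall on ('X - 1)^n. This leaves n! times (1 + 1)^n, which is what
    Rodrigues' formula divides by. *)
Lemma horner1_legendre n : (psi n).[1] = 1.
Proof.
rewrite /legendre hornerZ X2sub1E exprMn derivn_XsubC_exp horner_exp hornerXsubC.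
rewrite opprK (_ : 1 + 1 = 2%:R :> R) // [n`!%:R * _]mulrC mulVf //.
Qed.

Lemma derivn_u_pm1 n i : (i < n)%N ->
  (u ^+ n)^`(i).[1] = 0 /\ (u ^+ n)^`(i).[-1] = 0.
Proof.
move=> ltin; rewrite X2sub1E exprMn derivn_XsubC_exp_lt //; split => //.
by rewrite mulrC derivn_XsubC_exp_lt.
Qed.

Lemma pint_legendreM n q :
  pint (psi n * q) = (2 ^+ n * n`!%:R)^-1 * ((-1) ^+ n * pint (u ^+ n * q^`(n))).
Proof.
by rewrite /legendre -scalerAl linearZ /= pint_bypartsn // => i /derivn_u_pm1.
Qed.

Lemma u_monic : u \is monic.
Proof. by rewrite X2sub1E rpredM ?monicXsubC. Qed.

Lemma size_u_exp n : size (u ^+ n) = (2 * n).+1.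
Proof.
rewrite X2sub1E exprMn size_Mmonic ?monic_exp ?monicXsubC //; last first.
  by rewrite monic_neq0 // monic_exp ?monicXsubC.
by rewrite !size_exp_XsubC addSn addnS addnn mul2n.
Qed.

Definition lead_legendre n : R := (2 ^+ n * n`!%:R)^-1 * ((2 * n) ^_ n)%:R.

Lemma coef_legendre n : (psi n)`_n = lead_legendre n.
Proof.
rewrite /legendre coefZ coef_derivn addnn -mul2n.
have := monic_exp n u_monic; rewrite monicE lead_coefE size_u_exp /= => /eqP ->.
by [].
Qed.

Lemma lead_legendre_neq0 n : lead_legendre n != 0.
Proof.
rewrite mulf_neq0 ?invr_eq0 ?mulf_neq0 ?expf_neq0 ?pnatr_eq0 -?lt0n ?fact_gt0 //.
by rewrite ffact_gt0 leq_pmull.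
Qed.

Lemma size_legendre_le n : (size (psi n) <= n.+1)%N.
Proof.
apply/leq_sizeP => j hj; rewrite /legendre coefZ coef_derivn.
by rewrite nth_default ?mul0rn ?mulr0 // size_u_exp mul2n -addnn ltn_add2l.
Qed.

Lemma derivn_small q n : (size q <= n)%N -> q^`(n) = 0.
Proof.
move=> hq; apply/polyP => i; rewrite coef_derivn coef0 nth_default ?mul0rn //.
exact: leq_trans hq (leq_addr _ _).
Qed.

Lemma derivn_top q n : (size q <= n.+1)%N -> q^`(n) = (n`!%:R * q`_n)%:P.
Proof.
move=> hq; apply/polyP => i; rewrite coef_derivn coefC.
case: i => [|i] /=; first by rewrite addn0 ffactnn mulr_natl.
rewrite nth_default ?mul0rn //.
by rewrite (leq_trans hq) // addnS ltnS leq_addr.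
Qed.

Lemma pint_legendre_lt n q : (size q <= n)%N -> pint (psi n * q) = 0.
Proof.
move=> hq; rewrite pint_legendreM derivn_small // mulr0 (linear0 (@pint R)).
by rewrite !mulr0.
Qed.

Lemma pintXn n : pint 'X^n = (1 + (-1) ^+ n) / n.+1%:R :> R.
Proof.
have := pint_deriv ('X^(n.+1) : {poly R}).
rewrite derivXn /= raddfMn /= !hornerXn expr1n exprS mulN1r opprK => <-.
by rewrite -(mulr_natr (pint _)) mulfK ?pnatr_eq0.
Qed.

(** Multiplying out one factor [u] gives a recursion on j that ends at the integrals of
    monomials. *)
Lemma pint_uS j n :
  pint (u ^+ j.+1 * 'X^n) = pint (u ^+ j * 'X^(n.+2)) - pint (u ^+ j * 'X^n).
Proof.
rewrite -(linearB (@pint R)); congr pint.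
by rewrite exprSr -!mulrA mulrBl mul1r -exprD mulrBr.
Qed.

Lemma pint_u_odd j n : odd n -> pint (u ^+ j * 'X^n) = 0.
Proof.
elim: j n => [|j IH] n on.
  by rewrite expr0 mul1r pintXn -signr_odd on subrr mul0r.
by rewrite pint_uS !IH ?subrr //= negbK.
Qed.

Lemma pint_u_even j k :
  pint (u ^+ j * 'X^(2 * k)) * \prod_(i < j.+1) (2 * (k + i) + 1)%:R
    = (-1) ^+ j * 2 ^+ j.+1 * j`!%:R.
Proof.
elim: j k => [|j IH] k.
  rewrite expr0 mul1r pintXn big_ord1 exprM sqrrN !expr1n addn0 addn1.
  by rewrite divfK ?pnatr_eq0 // expr0 expr1 mul1r fact0 mulr1.
(* The product of consecutive odd numbers can be extended at either end. The two end factors differ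
   by 2(j + 1), which is the new factor on the right-hand side. *)
pose Pi k j : R := \prod_(i < j.+1) (2 * (k + i) + 1)%:R.
have PiS : Pi k j.+1 = Pi k j * (2 * (k + j.+1) + 1)%:R by rewrite /Pi big_ord_recr.
have PiSl : Pi k j.+1 = (2 * k + 1)%:R * Pi k.+1 j.
  rewrite /Pi big_ord_recl addn0; congr (_ * _).
  by apply: eq_bigr => i _; rewrite lift0 addSnnS.
rewrite -/(Pi k j.+1) pint_uS.
have -> : (2 * k).+2 = (2 * k.+1)%N by rewrite mulnS.
rewrite mulrBl {1}PiSl PiS.
have h1 : _ * Pi k.+1 j = _ := IH k.+1; have h2 : _ * Pi k j = _ := IH k.
rewrite mulrCA h1 [X in _ - X]mulrA h2 factS !exprS.
ring.
Qed.

Lemma prod_odd n :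
  \prod_(i < n) (2 * i + 1)%:R * (2 ^+ n * n`!%:R) = (2 * n)`!%:R :> R.
Proof.
elim: n => [|n IH]; first by rewrite big_ord0 !mul1r.
rewrite big_ord_recr /= (_ : 2 * n.+1 = (2 * n).+2)%N ?mulnS // !factS !(natrM, exprS) -IH.
ring.
Qed.

Lemma fact_lead_legendre n :
  n`!%:R * lead_legendre n = (2 * n)`!%:R / (2 ^+ n * n`!%:R).
Proof.
rewrite /lead_legendre mulrCA mulrC -natrM mulnC; congr (_%:R / _).
rewrite -(ffact_fact (_ : n <= 2 * n)%N) ?leq_pmull //.
by rewrite {3}mul2n -addnn addnK.
Qed.

(** Rodrigues' formula moves n derivatives onto the second factor, which becomes a constant. Only
    the integral of [u ^+ n] is left, the case k = 0 of [pint_u_even]. *)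
Lemma norm_legendre n : pint (psi n * psi n) = 2 / (2 * n + 1)%:R.
Proof.
rewrite pint_legendreM derivn_top ?size_legendre_le // coef_legendre.
rewrite fact_lead_legendre [_ ^+ n * _%:P]mulrC mul_polyC linearZ /=.
have := pint_u_even n 0; rewrite muln0 expr0 mulr1 => hu.
have hP : \prod_(i < n.+1) (2 * (0 + i) + 1)%:R * (2 ^+ n * n`!%:R) =
          (2 * n + 1)%:R * (2 * n)`!%:R :> R.
  by rewrite big_ord_recr /= mulrAC prod_odd mulrC.
have N0 : 2 ^+ n * n`!%:R != 0 :> R by [].
have P0 : \prod_(i < n.+1) (2 * (0 + i) + 1)%:R != 0 :> R.
  by apply/prodf_neq0 => i _; rewrite pnatr_eq0 addn1.
have m0 : (2 * n + 1)%:R != 0 :> R by rewrite pnatr_eq0 addn1.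
have F0 : (2 * n)`!%:R != 0 :> R by rewrite pnatr_eq0 -lt0n fact_gt0.
have {}hu : pint (u ^+ n) * \prod_(i < n.+1) (2 * (0 + i) + 1)%:R =
    (-1) ^+ n * 2 * (2 ^+ n * n`!%:R).
  by rewrite hu exprS; ring.
move: hu hP N0 P0 m0 F0 (sqrr_sign R n).
move: (pint _) (\prod_(_ < _) _) (2 ^+ n * _) ((2 * n + 1)%:R) ((2 * n)`!%:R).
move: ((-1) ^+ n) => s I P N m F hI hm N0 P0 m0 F0 s2; have -> : I = s * 2 * N / P by rewrite -hI mulfK.
have -> : m = P * N / F by rewrite hm mulfK.
(* One sign comes from the n integrations by parts, the other from the integral of [u ^+ n]; they
   cancel. *)
transitivity (s ^+ 2 * (2 / (P * N / F))); last by rewrite s2 mul1r.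
by field; rewrite N0 F0 P0.
Qed.

Lemma legendre_orth i j : i != j -> pint (psi i * psi j) = 0.
Proof.
move=> nij; wlog ltji : i j nij / (j < i)%N.
  move=> H; move: (nij); rewrite neq_ltn => /orP[ltij|]; last exact: H.
  by rewrite mulrC H // eq_sym.
by rewrite pint_legendre_lt // (leq_trans (size_legendre_le j)).
Qed.

(** Subtracting the multiple of psi_n with the same leading coefficient lowers the size.
    Orthogonality then identifies each coefficient as an integral against psi_j. *)
Lemma legendre_expand n q : (size q <= n)%N ->
  q = \sum_(j < n) ((2 * j + 1)%:R / 2 * pint (psi j * q)) *: psi j.
Proof.
elim: n q => [|n IH] q hq.
  by rewrite big_ord0; apply/eqP; rewrite -size_poly_eq0 -leqn0.
pose a := q`_n / lead_legendre n.
pose r := q - a *: psi n.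
have hr : (size r <= n)%N.
  apply/leq_sizeP => j; rewrite leq_eqVlt => /predU1P[<-|ltnj].
    by rewrite coefB coefZ coef_legendre divfK ?lead_legendre_neq0 ?subrr.
  rewrite coefB coefZ !nth_default ?mulr0 ?subrr //.
    exact: leq_trans (size_legendre_le n) ltnj.
  exact: leq_trans hq ltnj.
have qE : q = r + a *: psi n by rewrite subrK.
have pq j : pint (psi j * q) = pint (psi j * r) + a * pint (psi j * psi n).
  by rewrite {1}qE mulrDr linearD /= -scalerAr linearZ.
rewrite big_ord_recr /= {1}qE (IH _ hr); congr (_ + _).
  apply: eq_bigr => j _; rewrite pq legendre_orth ?mulr0 ?addr0 //.
  by rewrite neq_ltn ltn_ord.
rewrite pq pint_legendre_lt // norm_legendre add0r; congr (_ *: _).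
have : (2 * n + 1)%:R != 0 :> R by rewrite pnatr_eq0 addn1.
by move: (2 * n + 1)%:R => m m0; field.
Qed.

End Legendre.

(** * The ESFR matrix *)

Section Matrices.
Variable R : realType.
Implicit Types q : {poly R}.
Local Notation psi := (legendre R).

Lemma legendre_sum_eq0 n (k : 'I_n -> R) :
  \sum_(j < n) k j *: psi j = 0 -> forall i, k i = 0.
Proof.
move=> s0 i; have := congr1 (fun q => pint (psi i * q)) s0.
rewrite mulr0 linear0 mulr_sumr linear_sum /= (bigD1 i) //= big1 => [|j ji].
  rewrite addr0 -scalerAr linearZ /= norm_legendre => /eqP.
  by rewrite mulf_eq0 mulf_eq0 invr_eq0 !pnatr_eq0 addn1 !orbF => /eqP.
by rewrite -scalerAr linearZ /= legendre_orth ?mulr0 // eq_sym.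
Qed.

Lemma legendre_basis_nth p (i : 'I_p.+1) :
  (legendre_basis R p)`_i = npolyp p.+1 (psi i).
Proof. by rewrite -tnth_nth tnth_mktuple. Qed.

Lemma npolyp_legendre p (i : 'I_p.+1) : npolyp p.+1 (psi i) = psi i :> {poly R}.
Proof. by rewrite npolypK // (leq_trans (size_legendre_le _ _)). Qed.

Lemma legendre_basis_free p : free (legendre_basis R p).
Proof.
apply/freeP => k hk; apply: (@legendre_sum_eq0 p.+1).
transitivity (val (\sum_(i < p.+1) k i *: (legendre_basis R p)`_i)).
  rewrite raddf_sum; apply: eq_bigr => i _.
  by rewrite legendre_basis_nth /= npolyp_legendre.
by rewrite hk.
Qed.

Lemma coord_legendre p (i : 'I_p.+1) q : (size q <= p.+1)%N ->
  coord (legendre_basis R p) i (npolyp p.+1 q) =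
  (2 * i + 1)%:R / 2 * pint (psi i * q).
Proof.
move=> hq; have -> : npolyp p.+1 q =
    \sum_(j < p.+1) ((2 * j + 1)%:R / 2 * pint (psi j * q)) *: (legendre_basis R p)`_j.
  apply/val_inj; rewrite /= npolypK // {1}(legendre_expand hq) raddf_sum /=.
  by apply: eq_bigr => j _; rewrite legendre_basis_nth npolyp_legendre.
by rewrite coord_sum_free // legendre_basis_free.
Qed.

Lemma size_derivn_le q k n : (size q <= n)%N -> (size q^`(k) <= n)%N.
Proof.
move=> hq; apply/leq_sizeP => j hj; rewrite coef_derivn nth_default ?mul0rn //.
by rewrite (leq_trans hq) // (leq_trans hj) // leq_addl.
Qed.

(** Derivatives stay within degree p, so the truncation [npolyp] loses nothing and D^k represents
    the k-th derivative exactly. *)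
Lemma diff_mx_exp p k (m n : 'I_p.+1) :
  (diff_mx R p ^+ k) m n = (2 * m + 1)%:R / 2 * pint (psi m * (psi n)^`(k)).
Proof.
have sz (i : 'I_p.+1) l : (size (psi i)^`(l) <= p.+1)%N.
  by rewrite size_derivn_le // (leq_trans (size_legendre_le _ _)).
elim: k m n => [|k IH] m n.
  rewrite expr0 mxE derivn0; have [<-|mn] := eqVneq m n.
    rewrite norm_legendre; have : (2 * m + 1)%:R != 0 :> R by rewrite pnatr_eq0 addn1.
    by move: (2 * m + 1)%:R => x x0; rewrite mulr1n; field.
  by rewrite legendre_orth // mulr0.
rewrite exprS mxE; under eq_bigr do rewrite mxE IH.
rewrite derivnS {2}(legendre_expand (sz n k)) raddf_sum /= mulr_sumr linear_sum mulr_sumr.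
apply: eq_bigr => j _ /=.
rewrite -derivn1 coord_legendre // derivZ pintZr derivn1; ring.
Qed.

Lemma mass_mxE p (m n : 'I_p.+1) :
  mass_mx R p m n = 2 / (2 * m + 1)%:R *+ (m == n).
Proof.
have -> : mass_mx R p m n = pint (psi m * psi n).
  by rewrite mxE /pint; apply: eq_Rintegral => x _; rewrite hornerM.
have [<-|mn] := eqVneq m n; first by rewrite norm_legendre mulr1n.
by rewrite legendre_orth.
Qed.


(** The constant value of the p-th derivative of psi_p. *)
Definition deriv_top_legendre p : R := p`!%:R * lead_legendre R p.

Lemma diff_mx_expp p (m n : 'I_p.+1) :
  (diff_mx R p ^+ p) m n = deriv_top_legendre p *+ ((m == 0 :> nat) && (n == p :> nat)).
Proof.
rewrite diff_mx_exp; have [np|] := eqVneq (n : nat) p; last first.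
  rewrite andbF => np; have {}np : (n < p)%N by rewrite ltn_neqAle np -ltnS /=.
  rewrite derivn_small ?mulr0 ?(linear0 (@pint R)) ?mulr0 //.
  exact: leq_trans (size_legendre_le _ _) np.
rewrite andbT np derivn_top ?size_legendre_le // coef_legendre -/(deriv_top_legendre p).
have [->|m0] := eqVneq (m : nat) 0%N.
  have -> : psi 0 = 1 by rewrite /legendre expr0 fact0 mul1r invr1 scale1r.
  rewrite mul1r -[_%:P]mulr1 mul_polyC -[_ *: 1]mul1r pintZr mulr1.
  have := pintXn R 0; rewrite !expr0 => ->; rewrite muln0 add0n.
  by rewrite [RHS]mulr1n; field.
rewrite mulr0n pint_legendre_lt ?mulr0 // (leq_trans (size_polyC_leq1 _)) //.
by rewrite lt0n.
Qed.

Definition MKdiag p (c : R) : 'rV[R]_p.+1 :=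
  \row_j (2 / (2 * j + 1)%:R + c * deriv_top_legendre p ^+ 2 *+ (j == p :> nat)).

Lemma mass_add_esfr_mx p c : mass_mx R p + esfr_mx p c = diag_mx (MKdiag p c).
Proof.
have massE : mass_mx R p = diag_mx (\row_j (2 / (2 * j + 1)%:R)).
  by apply/matrixP => m n; rewrite mass_mxE [RHS]mxE mxE.
apply/matrixP => m n; rewrite /esfr_mx massE.
rewrite [LHS]mxE [X in _ + X]mxE mul_mx_diag.
(* Only row 0 of D^p is nonzero. The corresponding entry of M is 2, which cancels the 1/2 in K. *)
rewrite [X in _ + _ * X]mxE (bigD1 ord0) //= big1 ?addr0 => [|a a0]; last first.
  have a0n : (a == 0 :> nat) = false by apply/negbTE.
  by rewrite diff_mx_expp a0n mulr0n mulr0.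
rewrite !mxE !diff_mx_expp eqxx /= muln0 add0n divr1.
have [<-|mn] := eqVneq m n.
  rewrite !mulr1n; congr (_ + _); have [mp|mp] := eqVneq (m : nat) p.
    by rewrite !mulr1n; field.
  by rewrite !mulr0n !mulr0.
rewrite !mulr0n add0r; have [mp|mp] := eqVneq (m : nat) p; last by rewrite !mul0r mulr0.
have [np|np] := eqVneq (n : nat) p; last by rewrite !mulr0.
by case/eqP: mn; apply/val_inj; rewrite /= mp np.
Qed.

Section Inverse.
Variables (p : nat) (c : R).
Hypothesis hMK : mass_mx R p + esfr_mx p c \in unitmx.

Lemma MKdiag_neq0 j : MKdiag p c 0 j != 0.
Proof.
move: hMK; rewrite mass_add_esfr_mx unitmxE det_diag unitfE.
by move/prodf_neq0; apply.
Qed.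

Lemma esfr_qE j : esfr_q c j = (MKdiag p c 0 j)^-1.
Proof.
move: hMK MKdiag_neq0; rewrite /esfr_q mass_add_esfr_mx.
move: (MKdiag p c) => d ud d0.
have h : diag_mx d *m diag_mx (\row_i (d 0 i)^-1) = 1%:M.
  apply/matrixP => m n; rewrite mul_diag_mx !mxE.
  by have [_|_] := eqVneq m n; rewrite ?mulr0n ?mulr0 // !mulr1n divff.
have := congr1 (mulmx (invmx (diag_mx d))) h.
rewrite mulmxA mulVmx // mul1mx mulmx1 => <-.
by rewrite !mxE eqxx mulr1n.
Qed.

Lemma esfr_q_neq0 (j : 'I_p.+1) : esfr_q c j != 0.
Proof. by rewrite esfr_qE invr_eq0 MKdiag_neq0. Qed.

Lemma esfr_q_lt (j : 'I_p.+1) : (j < p)%N -> esfr_q c j = (2 * j + 1)%:R / 2.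
Proof. by move=> jp; rewrite esfr_qE mxE ltn_eqF // mulr0n addr0 invf_div. Qed.

(** Factoring 2 / (2p + 1) out of the last diagonal entry leaves 1 + c (2p + 1) d^2 / 2 with d =
    (2p)! / (2^p p!), the inverse of [f_corr]. *)
Lemma esfr_q_max : @esfr_q R p c ord_max = (2 * p + 1)%:R / 2 * f_corr p c.
Proof.
rewrite esfr_qE mxE eqxx mulr1n /f_corr -[_ / 2]invf_div -invfM; congr _^-1.
have -> : 2 ^+ (2 * p).+1 = 2 * (2 ^+ p) ^+ 2 :> R by rewrite exprS mulnC exprM.
rewrite /deriv_top_legendre fact_lead_legendre /= addn1.
have : (2 * p).+1%:R != 0 :> R by [].
have : p`!%:R != 0 :> R by rewrite pnatr_eq0 -lt0n fact_gt0.
have : 2 ^+ p != 0 :> R by [].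
move: (2 * p).+1%:R (p`!%:R) (2 ^+ p) (2 * p)`!%:R => a b d e d0 b0 a0.
by field; rewrite a0 b0 d0.
Qed.

End Inverse.
End Matrices.

(** * The Gamma function at half-integers *)

Section HalfIntegerGamma.
Variable R : realType.
Implicit Types (x t a : R) (n : nat).

Definition gauss_prim x : R := \int[lebesgue_measure]_(t in `[(0 : R), x]) gauss_fun t.

Lemma is_derive_gauss_prim x : 0 < x -> is_derive x 1 gauss_prim (gauss_fun x).
Proof.
move=> x0; suff [d e] : derivable gauss_prim x 1 /\ derive1 gauss_prim x = gauss_fun x.
  by split; [exact: d|rewrite -derive1E; exact: e].
apply: (@continuous_FTC1 R gauss_fun (BLeft 0) _ (x + 1)).
- by rewrite ltrDl.
- apply: continuous_compact_integrable; first exact: segment_compact.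
  by apply: continuous_subspaceT; exact: continuous_gauss_fun.
- by rewrite /= lte_fin.
- exact: continuous_gauss_fun.
Qed.

Lemma gauss_prim_cvg0 : gauss_prim x @[x --> (0 : R)] --> (0 : R).
Proof.
apply: (@parameterized_integral_cvg_left R 0 1 gauss_fun) => //.
apply: continuous_compact_integrable; first exact: segment_compact.
by apply: continuous_subspaceT; exact: continuous_gauss_fun.
Qed.

Lemma gauss_prim_cvgy : gauss_prim x @[x --> +oo] --> Num.sqrt pi / 2.
Proof.
(* The available limit is that of the square; nonnegativity of the integral allows taking roots. *)
have : Num.sqrt (gauss_prim x ^+ 2) @[x --> +oo] --> Num.sqrt (pi / 4 : R).
  by apply: continuous_cvg;
    [exact: sqrt_continuous|exact: gauss_integral_proof.cvg_integral0_gauss_sqr].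
rewrite sqrtrM ?pi_ge0// sqrtrV// (_ : 4 = 2 ^+ 2); last by rewrite expr2 -natrM.
rewrite sqrtr_sqr ger0_norm// (_ : (fun _ => Num.sqrt _) = gauss_prim)//.
apply/funext => r; rewrite sqrtr_sqr ger0_norm//.
exact: gauss_integral_proof.integral0_gauss_ge0.
Qed.

Lemma powRexpN_cvgy a : t `^ a * expR (- t) @[t --> +oo] --> (0 : R).
Proof.
(* For t >= 1, t^a is at most t^(m+1), while e^t is at least t^(m+2) / (m+2)!. This yields the
   dominating function (m+2)! / t. *)
pose m := Num.trunc `|a|.
have am : a <= m.+1%:R by rewrite (le_trans (ler_norm _)) // ltW // truncnS_gt.
apply: (@squeeze_cvgr _ _ _ _ (fun=> 0) (fun t => m.+2`!%:R * t^-1)).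
- near=> t; have t1 : 1 <= t by near: t; exact: nbhs_pinfty_ge.
  have t0 : 0 < t by apply: lt_le_trans t1.
  rewrite mulr_ge0 ?powR_ge0 ?expR_ge0 //= expRN ler_pdivrMr ?expR_gt0 //.
  have h1 : t `^ a <= t ^+ m.+1 by rewrite -powR_mulrn ?(ltW t0) // ler_powR.
  have h2 : t ^+ m.+2 / m.+2`!%:R <= expR t.
    by rewrite (le_trans _ (expR_ge1Dxn m.+1 (ltW t0))) // lerDr.
  rewrite (le_trans h1) // mulrAC ler_pdivlMr // -exprSr mulrC -ler_pdivrMr //.
- exact: cvg_cst.
- rewrite -[X in _ --> X](mulr0 (m.+2`!%:R : R)); apply: cvgM; first exact: cvg_cst.
  apply: (iffRL (gtr0_cvgV0 _)); last exact: cvg_id.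
  exact: nbhs_pinfty_gt.
Unshelve. all: by end_near. 
Qed.

Lemma powR_cvg a t : 0 < t -> x `^ a @[x --> t] --> t `^ a.
Proof.
move=> t0; suff : {for t, continuous (fun x : R => x `^ a)} by [].
apply: differentiable_continuous; apply/derivable1_diffP.
by apply: derivable_powR; rewrite in_itv /= andbT.
Qed.

Lemma expRN_cvg t : expR (- x) @[x --> t] --> expR (- t).
Proof.
suff : {for t, continuous (fun x : R => expR (- x))} by [].
by apply: continuous_comp; [exact: continuousN|exact: continuous_expR].
Qed.

Lemma powRexpN_cvg a t : 0 < t ->
  x `^ a * expR (- x) @[x --> t] --> t `^ a * expR (- t).
Proof. by move=> t0; apply: cvgM; [exact: powR_cvg|exact: expRN_cvg]. Qed.

(** An antiderivative of [t^(n - 1/2) e^-t], by parts from [n = 0], where the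
substitution [t = s^2] leads to Gauss' integral. *)
Fixpoint Gamma_prim n t : R :=
  if n is m.+1 then (m%:R + 2^-1) * Gamma_prim m t - t `^ (m%:R + 2^-1) * expR (- t)
  else 2 * gauss_prim (Num.sqrt t).

Lemma is_derive_Gamma_prim n t : 0 < t ->
  is_derive t 1 (Gamma_prim n) (t `^ (n%:R - 2^-1) * expR (- t)).
Proof.
move=> t0; elim: n => [|n IH] /=.
  have s0 : 0 < Num.sqrt t by rewrite sqrtr_gt0.
  have := is_derive_gauss_prim s0 => h1; have h2 := is_derive1_sqrt t0.
  have -> : (fun t => 2 * gauss_prim (Num.sqrt t)) = 2 *: (gauss_prim \o Num.sqrt) by [].
  apply: is_derive_eq.
  rewrite /gauss_fun sqr_sqrtr ?ltW // add0r powRN powR12_sqrt ?ltW //.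
  by rewrite /GRing.scale /=; field; rewrite gt_eqF.
have h := is_derive1_powR (n%:R + 2^-1) t0.
apply: is_derive_eq.
have -> : n.+1%:R - 2^-1 = n%:R + 2^-1 :> R by rewrite -natr1; field.
have -> : n%:R + 2^-1 - 1 = n%:R - 2^-1 :> R by field.
rewrite /GRing.scale /=; ring.
Qed.

Lemma Gamma_prim_cvg0 n : Gamma_prim n t @[t --> 0^'+] --> (0 : R).
Proof.
elim: n => [|n IH] /=.
  rewrite -[X in _ --> X](mulr0 2); apply: cvgM; first exact: cvg_cst.
  have h : (Num.sqrt : R -> R) x @[x --> (0 : R)] --> (0 : R).
    by rewrite -[X in _ --> X](sqrtr0 R); exact: sqrt_continuous.
  by apply: cvg_at_right_filter; exact: cvg_comp h gauss_prim_cvg0.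
rewrite -[X in _ --> X](subrr 0); apply: cvgB.
  by rewrite -[X in _ --> X](mulr0 (n%:R + 2^-1)); apply: cvgM IH; exact: cvg_cst.
rewrite -[X in _ --> X](mul0r (expR (- 0))); apply: cvgM.
  by apply: powR_cvg0; rewrite ltr_wpDl.
exact/cvg_at_right_filter/expRN_cvg.
Qed.

Lemma Gamma_prim0 n : Gamma_prim n 0 = 0.
Proof.
elim: n => [|n IH] /=.
  by rewrite sqrtr0 /gauss_prim set_itv1 Rintegral_set1 mulr0.
by rewrite IH mulr0 powR0 ?mul0r ?subrr // gt_eqF // ltr_wpDl.
Qed.

(** The classical value of Gamma at n + 1/2. *)
Definition Gamma_half_val n : R := (\prod_(i < n) (i%:R + 2^-1)) * Num.sqrt pi.

Lemma Gamma_prim_cvgy n : Gamma_prim n t @[t --> +oo] --> Gamma_half_val n.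
Proof.
elim: n => [|n IH] /=.
  rewrite /Gamma_half_val big_ord0 mul1r.
  rewrite (_ : Num.sqrt pi = 2 * (Num.sqrt pi / 2)); last by field.
  apply: cvgM; first exact: cvg_cst.
  suff h : (Num.sqrt : R -> R) x @[x --> +oo] --> +oo by exact: cvg_comp h gauss_prim_cvgy.
  apply/cvgryPge => A; near=> t.
  have tA : A ^+ 2 <= t by near: t; apply: nbhs_pinfty_ge; exact: num_real.
  by rewrite (le_trans (ler_norm A)) // -sqrtr_sqr ler_wsqrtr.
rewrite /Gamma_half_val big_ord_recr /= [_ * (n%:R + _)]mulrC -mulrA -[X in _ --> X]subr0.
apply: cvgB; last exact: powRexpN_cvgy.
by apply: cvgM IH; exact: cvg_cst.
Unshelve. all: by end_near.
Qed.

(** With [n.+1] the exponent in the integrand is n + 1/2 > 0, so the integrand is continuous on the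
    closed half-line, as the fundamental theorem on [[0, +oo[] requires. *)
Lemma Gamma_half n : Gamma (n.+1%:R + 2^-1) = Gamma_half_val n.+1.
Proof.
pose f t : R := t `^ (n%:R + 2^-1) * expR (- t).
have E : n.+1%:R + 2^-1 - 1 = n%:R + 2^-1 :> R by rewrite -natr1; field.
have E2 : n.+1%:R - 2^-1 = n%:R + 2^-1 :> R by rewrite -natr1; field.
have n2 : 0 < n%:R + 2^-1 :> R by rewrite ltr_wpDl.
have cf : {within `[0, +oo[, continuous f}.
  apply/continuous_within_itvcyP; split.
    move=> t; rewrite in_itv /= andbT => t0.
    exact: powRexpN_cvg.
  rewrite /f powR0 ?gt_eqF //; apply: cvgM; first exact: powR_cvg0.
  exact/cvg_at_right_filter/expRN_cvg.
rewrite /Gamma E /Rintegral integral_itv_obnd_cbnd; last first.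
  apply/measurable_realfun.measurable_EFinP.
  apply: measurable_realfun.open_continuous_measurable_fun => //.
  by move: cf => /continuous_within_itvcyP[/in_continuous_mksetP].
rewrite (@ge0_continuous_FTC2y _ f (Gamma_prim n.+1) 0 (Gamma_half_val n.+1)).
- by rewrite Gamma_prim0 /= subr0.
- by move=> t t0; rewrite mulr_ge0 ?powR_ge0 ?expR_ge0.
- exact: cf.
- exact: Gamma_prim_cvgy.
- by move=> t t0; have [] := @is_derive_Gamma_prim n.+1 t t0.
- by rewrite Gamma_prim0; exact: Gamma_prim_cvg0.
- move=> t; rewrite in_itv /= andbT => t0; have [_] := @is_derive_Gamma_prim n.+1 t t0.
  by rewrite derive1E => ->; rewrite E2.
Qed.

End HalfIntegerGamma.

(** * Power series expansions *)

Section ComplexExp.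
Variable R : realType.
Implicit Types (x y t : R) (z w : R[i]) (n N : nat).

(** Both g + f and g - f have nonnegative derivative on ]0, 1[ and vanish at 0. *)
Lemma norm_le_deriv (f g f' g' : R -> R) :
  (forall t, is_derive t 1 f (f' t)) -> (forall t, is_derive t 1 g (g' t)) ->
  (forall t, 0 < t < 1 -> `|f' t| <= g' t) -> f 0 = 0 -> g 0 = 0 ->
  forall t, 0 <= t <= 1 -> `|f t| <= g t.
Proof.
move=> df dg fg f0 g0 t /andP[t0 t1].
have key (h h' : R -> R) : (forall t, is_derive t 1 h (h' t)) ->
    (forall t, 0 < t < 1 -> 0 <= h' t) -> h 0 = 0 -> 0 <= h t.
  move=> dh h'0 <-; apply: (@ger0_derive1_ndecr R h 0 1) => //.
  - by move=> s; rewrite in_itv /= derive1E; have [_ ->] := dh s; exact: h'0.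
  - by apply: derivable_within_continuous => s _; have [] := dh s.
rewrite ler_norml; apply/andP; split.
  rewrite -subr_ge0 opprK; apply: (key (f \+ g) (f' \+ g')) => [s s01|].
  - by have := fg s s01; rewrite ler_norml /= -subr_ge0 opprK => /andP[].
  - by rewrite /= f0 g0 addr0.
rewrite -subr_ge0; apply: (key (g \- f) (g' \- f')) => [s s01|].
- by have := fg s s01; rewrite ler_norml subr_ge0 => /andP[].
- by rewrite /= f0 g0 subr0.
Qed.

Lemma is_derive_cXn (k x : R) n :
  is_derive x 1 (fun x : R => k * x ^+ n.+1) (k * n.+1%:R * x ^+ n).
Proof.
have := is_derive_poly (k *: 'X^(n.+1)) x.
rewrite derivZ derivXn hornerZ hornerMn hornerXn /= -(mulr_natl (x ^+ n)) mulrA.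
by rewrite (_ : horner _ = fun x => k * x ^+ n.+1) //; apply/funext => t; rewrite !hornerE.
Qed.

Lemma norm_cos_le1 x : `|cos x| <= 1.
Proof. by rewrite ler_norml cos_geN1 cos_le1. Qed.

Lemma norm_sin_le1 x : `|sin x| <= 1.
Proof. by rewrite ler_norml sin_geN1 sin_le1. Qed.

Definition l1norm z : R := `|complex.Re z| + `|complex.Im z|.

Lemma l1norm_ge0 z : 0 <= l1norm z. Proof. by rewrite addr_ge0. Qed.

Lemma le_norm_l1norm z : `|z| <= (l1norm z)%:C.
Proof.
case: z => a b; rewrite normc_def lecR /l1norm /=.
rewrite -(ger0_norm (addr_ge0 (normr_ge0 a) (normr_ge0 b))).
rewrite -sqrtr_sqr ler_wsqrtr // sqrrD !real_normK ?num_real // lerD2r lerDl.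
by rewrite mulrn_wge0 // mulr_ge0.
Qed.

Lemma l1norm_le_norm z : (l1norm z)%:C <= 2 * `|z|.
Proof.
case: z => a b; rewrite normc_def /l1norm /= mulr_natl mulr2n -!rmorphD lecR.
by apply: lerD; rewrite -sqrtr_sqr ler_wsqrtr // ?lerDl ?lerDr sqr_ge0.
Qed.

Section Taylor.
Variables (x y : R).
Let z := x +i* y.
Let u N t : R :=
  expR (t * x) * cos (t * y) - (\poly_(i < N) (complex.Re (z ^+ i) / i`!%:R)).[t].
Let v N t : R :=
  expR (t * x) * sin (t * y) - (\poly_(i < N) (complex.Im (z ^+ i) / i`!%:R)).[t].

Let dexp t : is_derive t 1 (fun t : R => expR (t * x)) (x * expR (t * x)).
Proof.
have h : is_derive t 1 (fun t : R => t * x) x.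
  by apply: is_derive_eq; rewrite scaler0 add0r /GRing.scale /= mulr1.
by have := @is_derive1_comp R expR _ t _ _ (is_derive_expR (t * x)) h; rewrite mulrC.
Qed.

Let dtrig t : is_derive t 1 (fun t : R => cos (t * y)) (- y * sin (t * y)) /\
  is_derive t 1 (fun t : R => sin (t * y)) (y * cos (t * y)).
Proof.
have h : is_derive t 1 (fun t : R => t * y) y.
  by apply: is_derive_eq; rewrite scaler0 add0r /GRing.scale /= mulr1.
split.
  have := @is_derive1_comp R cos _ t _ _ (is_derive_cos (t * y)) h.
  by rewrite mulrC mulrN mulNr.
by have := @is_derive1_comp R sin _ t _ _ (is_derive_sin (t * y)) h; rewrite mulrC.
Qed.

Let dRe N : (\poly_(i < N.+1) (complex.Re (z ^+ i) / i`!%:R))^`() =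
  x *: \poly_(i < N) (complex.Re (z ^+ i) / i`!%:R)
  - y *: \poly_(i < N) (complex.Im (z ^+ i) / i`!%:R).
Proof.
apply/polyP => i; rewrite coef_deriv coefB !coefZ !coef_poly ltnS.
case: ifP => _; last by rewrite mul0rn !mulr0 subrr.
rewrite factS natrM exprS; case: (z ^+ i) => a b /=.
rewrite -[LHS]mulr_natr; have : i`!%:R != 0 :> R by rewrite pnatr_eq0 -lt0n fact_gt0.
have : i.+1%:R != 0 :> R by [].
by move: (i`!%:R) (i.+1%:R) => d e e0 d0; field; rewrite e0 d0.
Qed.

Let dIm N : (\poly_(i < N.+1) (complex.Im (z ^+ i) / i`!%:R))^`() =
  x *: \poly_(i < N) (complex.Im (z ^+ i) / i`!%:R)
  + y *: \poly_(i < N) (complex.Re (z ^+ i) / i`!%:R).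
Proof.
apply/polyP => i; rewrite coef_deriv coefD !coefZ !coef_poly ltnS.
case: ifP => _; last by rewrite mul0rn !mulr0 addr0.
rewrite factS natrM exprS; case: (z ^+ i) => a b /=.
rewrite -[LHS]mulr_natr; have : i`!%:R != 0 :> R by rewrite pnatr_eq0 -lt0n fact_gt0.
have : i.+1%:R != 0 :> R by [].
by move: (i`!%:R) (i.+1%:R) => d e e0 d0; field; rewrite e0 d0.
Qed.

(* [(u, v)] are the real and imaginary parts of [g_N(t) = e^(tz) - T_N(tz)],
with [T_N] the Taylor polynomial, and [g_(N+1)' = z g_N]. *)
Let du N t : is_derive t 1 (u N.+1) (x * u N t - y * v N t).
Proof.
have he := dexp t; have [hc hs] := dtrig t.
rewrite /u; apply: is_derive_eq; rewrite dRe !hornerE /v /GRing.scale /=. ring.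
Qed.

Let dv N t : is_derive t 1 (v N.+1) (x * v N t + y * u N t).
Proof.
have he := dexp t; have [hc hs] := dtrig t.
rewrite /v; apply: is_derive_eq; rewrite dIm !hornerE /u /GRing.scale /=; ring.
Qed.

Let C := expR `|x|.
Let M : R := `|x| + `|y|.

(** Each derivative is a combination of the previous remainders with coefficients of size |x| and
    |y|, hence at most [M] times their common bound; integrating from 0 gives the next bound. [C]
    dominates e^(tx) when N = 0. *)
Lemma taylor_remainder N t : 0 <= t <= 1 ->
  `|u N t| <= C * M ^+ N / N`!%:R * t ^+ N /\ `|v N t| <= C * M ^+ N / N`!%:R * t ^+ N.
Proof.
elim: N t => [|N IH] t t01.
  have e1 : expR (t * x) <= C.
    rewrite ler_expR (le_trans (ler_norm _)) // normrM ler_piMl //.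
    by rewrite ger0_norm; move/andP: t01 => [].
  rewrite /u /v expr0 mulr1 fact0 divr1 mulr1 !poly_def !big_ord0 hornerC !subr0 !normrM.
  rewrite (ger0_norm (expR_ge0 _)).
  by split; rewrite -[leRHS]mulr1 ler_pM ?expR_ge0 ?norm_cos_le1 ?norm_sin_le1.
have dg (s : R) : is_derive s 1 (fun s : R => C * M ^+ N.+1 / N.+1`!%:R * s ^+ N.+1)
    (M * (C * M ^+ N / N`!%:R * s ^+ N)).
  suff <- : C * M ^+ N.+1 / N.+1`!%:R * N.+1%:R * s ^+ N =
      M * (C * M ^+ N / N`!%:R * s ^+ N) by exact: is_derive_cXn.
  rewrite factS natrM exprS.
  have : N`!%:R != 0 :> R by rewrite pnatr_eq0 -lt0n fact_gt0.
  have : N.+1%:R != 0 :> R by [].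
  by move: (N`!%:R) (N.+1%:R) => a b b0 a0; field; rewrite a0 b0.
have M0 : 0 <= M by rewrite addr_ge0.
split.
  apply: norm_le_deriv (du N) dg _ _ _ _ t01 => [s /andP[s0 s1]||].
  - have [|h1 h2] := IH s; first by rewrite !ltW.
    rewrite (le_trans (ler_normB _ _)) // !normrM mulrDl.
    by rewrite lerD // ler_wpM2l.
  - rewrite /u !mul0r expR0 cos0 mulr1 horner_coef0 coef_poly /= fact0 divr1.
    by rewrite subrr.
  - by rewrite expr0n mulr0.
apply: norm_le_deriv (dv N) dg _ _ _ _ t01 => [s /andP[s0 s1]||].
- have [|h1 h2] := IH s; first by rewrite !ltW.
  rewrite (le_trans (ler_normD _ _)) // !normrM mulrDl.
  by rewrite lerD // ler_wpM2l.
- by rewrite /v !mul0r expR0 sin0 mulr0 horner_coef0 coef_poly /= mul0r subrr.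
- by rewrite expr0n mulr0.
Qed.

End Taylor.

Lemma ReD z w : complex.Re (z + w) = complex.Re z + complex.Re w.
Proof. by case: z w => [a b] [c d]. Qed.

Lemma ImD z w : complex.Im (z + w) = complex.Im z + complex.Im w.
Proof. by case: z w => [a b] [c d]. Qed.

Lemma l1norm_sub z w :
  l1norm (z - w) = `|complex.Re z - complex.Re w| + `|complex.Im z - complex.Im w|.
Proof. by case: z w => [a b] [c d]. Qed.

Lemma cexp_remainder N z :
  `|cexp z - \sum_(i < N) (i`!%:R^-1)%:C * z ^+ i| <=
  (2 * expR (l1norm z) * l1norm z ^+ N / N`!%:R)%:C.
Proof.
apply: le_trans (le_norm_l1norm _) _; rewrite lecR; case: z => x y.
have [|hu hv] := @taylor_remainder x y N 1; first by rewrite ler01 lexx.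
rewrite !mul1r expr1n mulr1 !horner_poly in hu hv.
have hS (r : nat -> R) (w : nat -> R[i]) (m : nat) :
    complex.Re (\sum_(i < m) (r i)%:C * w i) = \sum_(i < m) complex.Re (w i) * r i /\
    complex.Im (\sum_(i < m) (r i)%:C * w i) = \sum_(i < m) complex.Im (w i) * r i.
  elim: m => [|m [h1 h2]]; first by rewrite !big_ord0.
  rewrite !big_ord_recr /= ReD ImD h1 h2; case: (w m) => a b /=.
  by rewrite !mul0r subr0 addr0 !(mulrC (r m)).
have [h1 h2] := hS (fun i => i`!%:R^-1) (fun i => (x +i* y) ^+ i) N.
have e1 : \sum_(i < N) complex.Re ((x +i* y) ^+ i) / i`!%:R * 1 ^+ i =
    complex.Re (\sum_(i < N) (i`!%:R^-1)%:C * (x +i* y) ^+ i).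
  by rewrite h1; apply: eq_bigr => i _; rewrite expr1n mulr1.
have e2 : \sum_(i < N) complex.Im ((x +i* y) ^+ i) / i`!%:R * 1 ^+ i =
    complex.Im (\sum_(i < N) (i`!%:R^-1)%:C * (x +i* y) ^+ i).
  by rewrite h2; apply: eq_bigr => i _; rewrite expr1n mulr1.
(* The factor 2 splits into one bound for the real part and one for the imaginary part. *)
rewrite l1norm_sub -e1 -e2 /= !mul0r subr0 addr0 -!mulrA mulr_natl mulr2n.
have hle : expR `|x| * (`|x| + `|y|) ^+ N / N`!%:R <=
    expR (l1norm (x +i* y)) * (l1norm (x +i* y) ^+ N / N`!%:R).
  rewrite -mulrA ler_wpM2r ?ler_expR ?lerDl //.
by apply: lerD; [apply: le_trans hu hle | apply: le_trans hv hle].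
Qed.

(** The second clause, an expansion to every order with a remainder bounded on
the unit disc, spares any estimate of tails of series. *)
Definition has_pseries (a : nat -> R) (f : R[i] -> R[i]) :=
  (forall z, series (fun n => (a n)%:C * z ^+ n : R[i]^o) @ \oo --> (f z : R[i]^o)) /\
  (forall N, exists (g : R[i] -> R[i]) (K : R[i]), forall z,
    f z = \sum_(n < N) (a n)%:C * z ^+ n + z ^+ N * g z /\ (`|z| <= 1 -> `|g z| <= K)).

Lemma has_pseries_cexp : has_pseries (fun n => n`!%:R^-1) (@cexp R).
Proof.
split=> [z|N].
  have h : (2 * expR (l1norm z)) * (l1norm z ^+ N / N`!%:R) @[N --> \oo] --> (0 : R).
    rewrite -[X in _ --> X](mulr0 (2 * expR (l1norm z))).
    by apply: cvgM; [exact: cvg_cst | exact: cvg_exp_coeff].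
  apply/cvgrPdist_le => /= e e0.
  (* A positive element of R[i] is real, so the estimate reduces to one over R. *)
  have eE : e = (complex.Re e)%:C by rewrite RRe_real // gtr0_real.
  move: e0; rewrite eE ltcR => e0; move/cvgrPdist_le : h => /(_ _ e0) h.
  near=> N.
  have : `|0 - 2 * expR (l1norm z) * (l1norm z ^+ N / N`!%:R)| <= complex.Re e.
    by near: N.
  rewrite sub0r normrN ger0_norm => [hN|]; last first.
    by rewrite !mulr_ge0 ?expR_ge0 ?exprn_ge0 ?l1norm_ge0.
  rewrite /series /= big_mkord (le_trans (cexp_remainder N z)) // lecR.
  by rewrite -mulrA.
pose S z := \sum_(n < N) (n`!%:R^-1)%:C * z ^+ n.
(* On the unit disc [l1norm z] is at most 2|z| <= 2, whence e^2 and 2^N. At z = 0 with N > 0 the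
   quotient is 0, as the inverse of 0 is 0. *)
exists (fun z => (cexp z - S z) / z ^+ N), ((2 * expR 2 * 2 ^+ N / N`!%:R)%:C) => z; split.
  rewrite -/(S z); have [->|z0] := eqVneq z 0; last first.
    by rewrite mulrC divfK ?expf_neq0 // addrC subrK.
  case: N @S => [|N] S.
    by rewrite /S big_ord0 add0r subr0 expr0 divr1 mul1r.
  rewrite exprS mul0r mul0r addr0 /S big_ord_recl big1 ?addr0 => [|i _].
    by rewrite expr0 mulr1 fact0 invr1 /cexp /= expR0 cos0 sin0 mul1r.
  by rewrite lift0 exprS mul0r mulr0.
move=> z1; have [->|z0] := eqVneq z 0.
  case: N @S => [|N] S.
    rewrite /S big_ord0 subr0 !expr0 !divr1 mulr1.
    have := cexp_remainder 0 0; rewrite big_ord0 subr0 expr0 mulr1 divr1 => /le_trans; apply.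
    by rewrite lecR ler_pM2l // ler_expR /l1norm /= normr0 addr0.
  by rewrite exprS mul0r invr0 mulr0 normr0 lecR !mulr_ge0 ?expR_ge0 ?exprn_ge0.
rewrite normrM normfV ler_pdivrMr ?normr_gt0 ?expf_neq0 //.
rewrite (le_trans (cexp_remainder N z)) //.
have := l1norm_le_norm z; rewrite normrX.
have -> : `|z| = (complex.Re `|z|)%:C by rewrite RRe_real.
set r := complex.Re `|z| => lr.
have {}lr : l1norm z <= 2 * r by rewrite -lecR rmorphM /= rmorph_nat.
have -> : (2 * expR 2 * 2 ^+ N / N`!%:R)%:C * r%:C ^+ N =
    (2 * expR 2 * 2 ^+ N / N`!%:R * r ^+ N)%:C by rewrite [RHS]rmorphM rmorphXn.
rewrite lecR.
have r1 : r <= 1 by rewrite -lecR RRe_real.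
rewrite -!mulrA !ler_pM2l //; apply: ler_pM; rewrite ?expR_ge0 //.
- by rewrite mulr_ge0 ?exprn_ge0 ?l1norm_ge0.
- by rewrite ler_expR (le_trans lr) // -[leRHS]mulr1 ler_pM2l.
- rewrite mulrCA -exprMn mulrC ler_wpM2l //.
  by rewrite lerXn2r // ?nnegrE ?l1norm_ge0 // (le_trans (l1norm_ge0 z)).
Unshelve. all: by end_near.
Qed.

(** * Closure properties of power series expansions *)

Lemma eq_has_pseries a b f g : a =1 b -> f =1 g -> has_pseries a f -> has_pseries b g.
Proof. by move=> /funext -> /funext ->. Qed.

Lemma has_pseries0 : has_pseries (fun=> 0) (fun=> 0).
Proof.
split=> [z|N].
  rewrite (_ : series _ = fun=> 0); first exact: cvg_cst.
  by apply/funext => n; rewrite /series /= big1 // => i _; rewrite mul0r.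
exists (fun=> 0), 0 => z; rewrite normr0 mulr0 addr0; split => //.
by rewrite big1 // => i _; rewrite mul0r.
Qed.

Lemma has_pseriesD a b f g : has_pseries a f -> has_pseries b g ->
  has_pseries (fun n => a n + b n) (fun z => f z + g z).
Proof.
move=> [af Af] [bg Bg]; split=> [z|N].
  rewrite (_ : series _ =
    series (fun n => (a n)%:C * z ^+ n) \+ series (fun n => (b n)%:C * z ^+ n)).
    by apply: cvgD; [exact: af|exact: bg].
  apply/funext => n; rewrite /series /= -big_split.
  by apply: eq_bigr => i _; rewrite rmorphD mulrDl.
have [f1 [K1 h1]] := Af N; have [g1 [K2 h2]] := Bg N.
exists (fun z => f1 z + g1 z), (K1 + K2) => z.
have [e1 l1] := h1 z; have [e2 l2] := h2 z; split.
  rewrite e1 e2 addrACA -big_split mulrDr; congr (_ + _).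
  by apply: eq_bigr => i _; rewrite rmorphD mulrDl.
by move=> z1; rewrite (le_trans (ler_normD _ _)) // lerD ?l1 ?l2.
Qed.

Lemma has_pseriesZ r a f : has_pseries a f ->
  has_pseries (fun n => r * a n) (fun z => r%:C * f z).
Proof.
move=> [af Af]; split=> [z|N].
  rewrite (_ : series _ = fun m => r%:C * series (fun n => (a n)%:C * z ^+ n) m).
    by apply: cvgM; [exact: cvg_cst|exact: af].
  apply/funext => n; rewrite /series /= mulr_sumr.
  by apply: eq_bigr => i _; rewrite rmorphM mulrA.
have [f1 [K1 h1]] := Af N.
exists (fun z => r%:C * f1 z), (`|r%:C| * K1) => z.
have [e1 l1] := h1 z; split.
  rewrite e1 mulrDr mulr_sumr mulrCA; congr (_ + _).
  by apply: eq_bigr => i _; rewrite rmorphM mulrA.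
by move=> z1; rewrite normrM ler_wpM2l ?l1.
Qed.

Lemma has_pseries_sum (I : Type) (s : seq I) (a : I -> nat -> R) (f : I -> R[i] -> R[i]) :
  (forall i, has_pseries (a i) (f i)) ->
  has_pseries (fun n => \sum_(i <- s) a i n) (fun z => \sum_(i <- s) f i z).
Proof.
move=> h; elim: s => [|i s IH].
  by apply: eq_has_pseries has_pseries0 => ?; rewrite big_nil.
by apply: eq_has_pseries (has_pseriesD (h i) IH) => ?; rewrite big_cons.
Qed.

Definition shift_coef (a : nat -> R) n : R := if n is m.+1 then a m else 0.

Lemma has_pseries_mulX a f : has_pseries a f -> has_pseries (shift_coef a) (fun z => z * f z).
Proof.
move=> [af Af]; split=> [z|N].
  rewrite -cvg_shiftS.
  rewrite (_ : [sequence _]_n = fun m => z * series (fun n => (a n)%:C * z ^+ n) m).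
    by apply: cvgM; [exact: cvg_cst|exact: af].
  apply/funext => n; rewrite /series /= big_nat_recl //= mul0r add0r mulr_sumr.
  by apply: eq_bigr => i _; rewrite exprS mulrCA.
(* Order N of the product uses order N - 1 of f. At N = 0 the factor z goes into the remainder
   instead, where |z| <= 1 keeps the bound. *)
case: N => [|N].
  have [f1 [K1 h1]] := Af 0%N; exists (fun z => z * f1 z), K1 => z.
  have [e1 l1] := h1 z; split; first by rewrite e1 !big_ord0 !add0r expr0 !mul1r.
  by move=> z1; rewrite normrM (le_trans _ (l1 z1)) // ler_piMl.
have [f1 [K1 h1]] := Af N; exists f1, K1 => z; have [e1 l1] := h1 z; split => //.
rewrite e1 mulrDr big_ord_recl /= mul0r add0r exprS mulrA mulr_sumr; congr (_ + _).
by apply: eq_bigr => i _; rewrite exprS mulrCA.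
Qed.

Lemma has_pseries_mulXn k a f : has_pseries a f ->
  has_pseries (iter k shift_coef a) (fun z => z ^+ k * f z).
Proof.
move=> h; elim: k => [|k IH].
  by apply: eq_has_pseries h => // z; rewrite mul1r.
by apply: eq_has_pseries (has_pseries_mulX IH) => // z; rewrite exprS mulrA.
Qed.

Lemma has_pseries_opp a f : has_pseries a f ->
  has_pseries (fun n => (-1) ^+ n * a n) (fun z => f (- z)).
Proof.
have E i z : (a i)%:C * (- z) ^+ i = ((-1) ^+ i * a i)%:C * z ^+ i.
  by rewrite (exprNn z) mulrA; congr (_ * _); rewrite mulrC [RHS]rmorphM rmorphXn rmorphN1.
move=> [af Af]; split=> [z|N].
  have := af (- z).
  rewrite (_ : series _ = series (fun n : nat => ((-1) ^+ n * a n)%:C * z ^+ n)) //.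
  by apply/funext => n; apply: eq_bigr => i _; exact: E.
have [f1 [K1 h1]] := Af N; exists (fun z => (-1) ^+ N * f1 (- z)), K1 => z.
have [e1 l1] := h1 (- z); split.
  rewrite e1 mulrA -(mulrC (_ ^+ N)) -exprNn; congr (_ + _); apply: eq_bigr => i _.
  exact: E.
by move=> z1; rewrite normrM normrX normrN1 expr1n mul1r l1 // normrN.
Qed.

End ComplexExp.

(** * Modified spherical Bessel functions *)

Section Bessel.
Variable R : realType.
Implicit Types (p q : {poly R}) (z : R[i]) (j k m n : nat).
Local Notation psi := (legendre R).
Local Notation u := ('X^2 - 1 : {poly R}).

(** The coefficient of z^n in the integral of p(t) e^(zt) over [-1, 1]. *)
Definition moment p n : R := pint (p * 'X^n) / n`!%:R.

Lemma moment_legendre_lt j n : (n < j)%N -> moment (psi j) n = 0.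
Proof. by move=> nj; rewrite /moment pint_legendre_lt ?mul0r // size_polyXn. Qed.

Lemma moment_legendre j n : moment (psi j) (n + j) =
  (2 ^+ j * j`!%:R)^-1 * ((-1) ^+ j * pint (u ^+ j * 'X^n)) / n`!%:R.
Proof.
rewrite /moment pint_legendreM derivnXn addnK -(scaler_nat _ 'X^n) pintZr.
rewrite -(ffact_fact (leq_addl n j)) addnK natrM.
have : ((n + j) ^_ j)%:R != 0 :> R by rewrite pnatr_eq0 -lt0n ffact_gt0 leq_addl.
have : n`!%:R != 0 :> R by rewrite pnatr_eq0 -lt0n fact_gt0.
have : 2 ^+ j * j`!%:R != 0 :> R by [].
move: (2 ^+ j * _) ((_ ^_ j)%:R) (n`!%:R) (pint _) => a b d e a0 d0 b0.
by field; rewrite a0 b0 d0.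
Qed.

Lemma moment_legendre_odd j n : odd n -> moment (psi j) (n + j) = 0.
Proof. by move=> on; rewrite moment_legendre pint_u_odd // !mulr0 mul0r. Qed.

Lemma moment_legendre_even j k : moment (psi j) (2 * k + j) =
  2 / ((2 * k)`!%:R * \prod_(i < j.+1) (2 * (k + i) + 1)%:R).
Proof.
rewrite moment_legendre; have h := pint_u_even R j k.
have P0 : \prod_(i < j.+1) (2 * (k + i) + 1)%:R != 0 :> R.
  by apply/prodf_neq0 => i _; rewrite pnatr_eq0 addn1.
rewrite (canRL (mulfK P0) h).
have : j`!%:R != 0 :> R by rewrite pnatr_eq0 -lt0n fact_gt0.
have : (2 * k)`!%:R != 0 :> R by rewrite pnatr_eq0 -lt0n fact_gt0.
have : 2 ^+ j != 0 :> R by [].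
rewrite exprS; move: P0 (sqrr_sign R j).
move: (\prod_(_ < _) _) ((-1) ^+ j) (2 ^+ j) (j`!%:R) ((2 * k)`!%:R) => P s t a b.
move=> P0 s2 t0 b0 a0; transitivity (s ^+ 2 * (2 / (b * P))); last by rewrite s2 mul1r.
by field; rewrite a0 b0 P0 t0.
Qed.

Lemma prod_half n : \prod_(i < n) (i%:R + 2^-1) = \prod_(i < n) (2 * i + 1)%:R / 2 ^+ n :> R.
Proof.
elim: n => [|n IH]; first by rewrite !big_ord0 expr0 divr1.
by rewrite !big_ord_recr /= IH exprS natrD natrM; field.
Qed.

(** The right-hand side is the coefficient of z^(2k+j) in 2 I_j(z). *)
Lemma moment_legendre_Gamma j k : moment (psi j) (2 * k + j) =
  Num.sqrt pi * 2^-1 ^+ (2 * k + j) / (k`!%:R * Gamma (k%:R + j%:R + 3 / 2)).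
Proof.
have -> : k%:R + j%:R + 3 / 2 = (k + j).+1%:R + 2^-1 :> R by field.
rewrite Gamma_half moment_legendre_even /Gamma_half_val prod_half -addnS.
(* Of the k + j + 1 odd factors in Gamma, the first k combine with k! into (2k)!; the others form
   the product in [moment_legendre_even]. *)
rewrite big_split_ord /=.
rewrite -prod_odd exprVn (exprD _ (2 * k)) (exprD _ k) (exprS _ j) (mulnC 2 k) exprM.
have O0 : \prod_(i < k) (2 * i + 1)%:R != 0 :> R.
  by apply/prodf_neq0 => i _; rewrite pnatr_eq0 addn1.
have P0 : \prod_(i < j.+1) (2 * (k + i) + 1)%:R != 0 :> R.
  by apply/prodf_neq0 => i _; rewrite pnatr_eq0 addn1.
have s0 : Num.sqrt pi != 0 :> R by rewrite gt_eqF // sqrtr_gt0 pi_gt0.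
have k0 : k`!%:R != 0 :> R by rewrite pnatr_eq0 -lt0n fact_gt0.
have t0 : 2 ^+ k != 0 :> R by [].
have r0 : 2 ^+ j != 0 :> R by [].
move: O0 P0 s0 k0 t0 r0.
move: (\prod_(i < k) _) (\prod_(i < j.+1) _) (Num.sqrt pi) (k`!%:R) (2 ^+ k) (2 ^+ j).
by move=> a b d e t r a0 b0 d0 e0 t0 r0; field; rewrite a0 b0 d0 e0 t0 r0.
Qed.

Lemma iter_shift_coefE n (a : nat -> R) m :
  iter n (@shift_coef R) a m = if (m < n)%N then 0 else a (m - n)%N.
Proof.
elim: n m => [|n IH] m; first by rewrite subn0.
by case: m => [|m] //=; rewrite IH ltnS subSS.
Qed.

(** [z^n] times the integral of [p(t) e^(zt)] over [-1, 1], for [p] of degree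
[< n], as repeated integration by parts evaluates it. *)
Definition exp_transform n p z : R[i] :=
  \sum_(k < n) (-1) ^+ k * z ^+ (n.-1 - k) *
    ((p^`(k).[1])%:C * cexp z - (p^`(k).[-1])%:C * cexp (- z)).

(** One integration by parts: a boundary term, minus the transform of the derivative. *)
Lemma exp_transformS n p z : exp_transform n.+1 p z =
  z ^+ n * ((p.[1])%:C * cexp z - (p.[-1])%:C * cexp (- z)) - exp_transform n p^`() z.
Proof.
rewrite /exp_transform big_ord_recl /= subn0 expr0 mul1r; congr (_ + _).
rewrite -sumrN; apply: eq_bigr => i _; rewrite /bump add1n add0n -derivnS derivSn exprS.
by rewrite mulN1r !mulNr; case: n i => [[]|n i] //=; rewrite subSS.
Qed.

(** Induction on the degree through [exp_transformS]. Comparing coefficients amounts to integrating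
    the derivative of p(t) t^m. *)
Lemma has_pseries_exp_transform n p : (size p <= n)%N ->
  has_pseries (iter n (@shift_coef R) (moment p)) (exp_transform n p).
Proof.
elim: n p => [|n IH] p hp.
  have -> : p = 0 by apply/eqP; rewrite -size_poly_leq0.
  apply: eq_has_pseries (has_pseries0 R) => x; last by rewrite /exp_transform big_ord0.
  by rewrite /= /moment mul0r linear0 mul0r.
have hp' : (size p^`() <= n)%N.
  have [->|p0] := eqVneq p 0; first by rewrite deriv0 size_poly0.
  by rewrite -ltnS (leq_trans (lt_size_deriv p0)).
have he := has_pseries_cexp R.
have h1 := has_pseriesD (has_pseriesZ p.[1] he)
  (has_pseriesZ (- p.[-1]) (has_pseries_opp he)).
have h2 := has_pseriesD (has_pseries_mulXn n h1) (has_pseriesZ (-1) (IH _ hp')).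
apply: eq_has_pseries h2 => [m|z]; last first.
  rewrite exp_transformS rmorphN1 mulN1r; congr (_ * (_ + _) - _).
  by rewrite rmorphN mulNr.
rewrite iterSr !iter_shift_coefE; case: ltnP => _; first by rewrite mulr0 addr0.
move: (m - n)%N => {}m.
have := pint_deriv (p * 'X^m); rewrite derivM raddfD /= !hornerM !hornerXn expr1n.
rewrite mulN1r derivXn /moment -(scaler_nat m 'X^(m.-1)) pintZr => h.
have m0 : m`!%:R != 0 :> R by rewrite pnatr_eq0 -lt0n fact_gt0.
have -> : pint (p^`() * 'X^m) =
    p.[1] * 1 - p.[-1] * (-1) ^+ m - m%:R * pint (p * 'X^(m.-1)).
  by rewrite -h addrK.
case: m {h} m0 => [|m] m0 /=; first by rewrite expr0; field.
rewrite factS natrM.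
have d0 : m`!%:R != 0 :> R by rewrite pnatr_eq0 -lt0n fact_gt0.
have e0 : m.+1%:R != 0 :> R by [].
move: (m`!%:R) (m.+1%:R) ((-1) ^+ m.+1) d0 e0 => d e s d0 e0.
by field; rewrite d0 e0.
Qed.

Lemma exp_transform0 n p : (0 < n)%N -> (size p <= n)%N -> exp_transform n p 0 = 0.
Proof.
case: n => // n _ hp; have [_ /(_ 1%N)[g [K /(_ 0)[-> _]]]] := has_pseries_exp_transform hp.
by rewrite big_ord1 /= mul0r mul0r addr0.
Qed.

(** Both sides have the same series away from 0. Convergence of the Bessel series is inherited from
    the expansion of [exp_transform]; at z = 0 both sides vanish because n > 0. *)
Lemma sph_besselIE n j z : (size (psi j) <= n)%N -> (0 < n)%N ->
  z ^+ n * (2 * sph_besselI j z) = exp_transform n (psi j) z.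
Proof.
move=> hn n0; have [->|z0] := eqVneq z 0.
  by rewrite exp_transform0 // expr0n gtn_eqF // mul0r.
have [/(_ z) h _] := has_pseries_exp_transform hn.
set sm := series _ in h.
pose T K : R[i] := \sum_(m < K) (moment (psi j) m)%:C * z ^+ m.
have smE K : sm (K + n)%N = z ^+ n * T K.
  rewrite /sm /series /= big_mkord addnC big_split_ord /= big1 ?add0r => [|i _].
    rewrite /T mulr_sumr; apply: eq_bigr => i _.
    by rewrite iter_shift_coefE ltnNge leq_addr /= addKn exprD mulrCA.
  by rewrite iter_shift_coefE ltn_ord mul0r.
pose b (k : nat) : R[i] := (z / 2) ^+ (2 * k + j) / (k`!%:R * Gamma (k%:R + j%:R + 3 / 2))%:C.
pose s : R[i] := (Num.sqrt pi)%:C.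
(* Moments below order j vanish, and so do those at odd distance from j. Truncating at 2K + j
   therefore leaves exactly K Bessel terms. *)
have TE K : T (2 * K + j)%N = s * \sum_(k < K) b k.
  elim: K => [|K IH].
    rewrite big_ord0 mulr0 /T muln0 add0n big1 // => i _.
    by rewrite moment_legendre_lt ?mul0r.
  have TS m : T m.+1 = T m + (moment (psi j) m)%:C * z ^+ m by rewrite /T big_ord_recr.
  rewrite (_ : 2 * K.+1 + j = (2 * K + j).+2)%N ?mulnS // !TS IH -addSn.
  have o : odd (2 * K).+1 by rewrite /= oddM.
  rewrite (moment_legendre_odd j o) mul0r addr0 big_ord_recr mulrDr.
  congr (_ + _); rewrite moment_legendre_Gamma /b exprMn_comm; last exact: mulrC.
  rewrite [in LHS]rmorphM [in LHS]rmorphM /= fmorphV rmorphXn fmorphV rmorph_nat.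
  by rewrite -/s -!mulrA; congr (_ * _); rewrite mulrA [RHS]mulrC.
have z0n : z ^+ n != 0 by rewrite expf_neq0.
have s0 : s != 0.
  by rewrite /s fmorph_eq0 gt_eqF // sqrtr_gt0 pi_gt0.
pose L := exp_transform n (psi j) z.
have hT : (T : nat -> R[i]^o) @ \oo --> (L / z ^+ n : R[i]^o).
  have := h; rewrite -(cvg_shiftn n) => h'.
  rewrite (_ : T = fun K => sm (K + n)%N / z ^+ n); last first.
    by apply/funext => K; rewrite smE mulrC mulKf.
  by apply: cvgM h' _; exact: cvg_cst.
have hsub : (fun K => (2 * K + j)%N) @ \oo --> \oo.
  move=> P [M _ hM]; exists M => // K /= MK; apply: hM => /=.
  by rewrite (leq_trans MK) // (leq_trans (leq_pmull K (isT : 0 < 2)%N)) // leq_addr.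
have hb : series (b : nat -> R[i]^o) @ \oo --> (L / z ^+ n / s : R[i]^o).
  rewrite (_ : series _ = fun K => T (2 * K + j)%N / s); last first.
    by apply/funext => K; rewrite TE /series /= big_mkord mulrC mulKf.
  apply: cvgM; last exact: cvg_cst.
  exact: (cvg_comp _ _ hsub hT).
rewrite /sph_besselI (cvg_lim _ hb) //.
have -> : (Num.sqrt pi / 2)%:C = s / 2 by rewrite rmorphM fmorphV rmorph_nat.
by rewrite -/L; field; rewrite z0n s0.
Qed.

End Bessel.

(** * The approximant *)

Section Final.
Variable R : realType.
Implicit Types (q : {poly R}) (z w : R[i]) (i j k m n : nat).
Local Notation psi := (legendre R).

Lemma cexpD z w : cexp (z + w) = cexp z * cexp w.
Proof.
case: z w => [a b] [c d]; apply/eqP; rewrite eq_complex /=.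
rewrite expRD sinD cosD !mul0r !subr0 !addr0.
by apply/andP; split; apply/eqP; ring.
Qed.

Lemma cexp0 : cexp (0 : R[i]) = 1.
Proof.
apply/eqP; rewrite eq_complex /= expR0 cos0 sin0.
by rewrite !mul0r !mulr0 subr0 addr0 mulr1 !eqxx.
Qed.

Lemma cexpNK z : cexp (- z) * cexp z = 1.
Proof. by rewrite -cexpD addNr cexp0. Qed.

Lemma derivn_comp_oppX q s k : q \Po (- 'X) = s *: q ->
  q^`(k) \Po (- 'X) = (-1) ^+ k * s *: q^`(k).
Proof.
elim: k q s => [|k IH] q s hq; first by rewrite mul1r.
rewrite derivSn (IH _ (- s)) ?exprS ?mulrN ?mulN1r ?mulNr //.
have := congr1 (@deriv R) hq; rewrite deriv_comp derivN derivX mulrN1 derivZ.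
by move=> h; rewrite scaleNr -h opprK.
Qed.

Lemma legendre_comp_oppX j : psi j \Po (- 'X) = (-1) ^+ j *: psi j.
Proof.
rewrite /legendre comp_polyZ (@derivn_comp_oppX _ 1) ?mulr1 ?scalerA 1?mulrC //.
by rewrite scale1r rmorphXn rmorphB rmorph1 /= comp_Xn_poly sqrrN.
Qed.

Lemma horner_derivn_legendre_opp j k x :
  (psi j)^`(k).[- x] = (-1) ^+ (k + j) * (psi j)^`(k).[x].
Proof.
have := congr1 (fun q => q.[x]) (derivn_comp_oppX k (legendre_comp_oppX j)).
by rewrite horner_comp hornerN hornerX hornerZ -exprD.
Qed.

(** The reciprocal of 1.3.5...(2n - 1). *)
Definition diag_coef n : R := 2 ^+ n * n`!%:R / (2 * n)`!%:R.

Lemma moment_legendre_diag n : (2 * n + 1)%:R / 2 * moment (psi n) n = diag_coef n.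
Proof.
have := moment_legendre_even R n 0; rewrite muln0 add0n fact0 mul1r => ->.
rewrite big_ord_recr /= add0n /diag_coef -prod_odd.
under eq_bigr do rewrite add0n.
have : \prod_(i < n) (2 * i + 1)%:R != 0 :> R.
  by apply/prodf_neq0 => i _; rewrite pnatr_eq0 addn1.
have : (2 * n + 1)%:R != 0 :> R by rewrite pnatr_eq0 addn1.
have : 2 ^+ n * n`!%:R != 0 :> R by [].
move: (\prod_(_ < _) _) (2 ^+ n * _) ((2 * n + 1)%:R) => a b d b0 d0 a0.
by field; rewrite a0 b0 d0.
Qed.

Lemma moment_expand n m : (m < n)%N ->
  m`!%:R^-1 = \sum_(j < n) (2 * j + 1)%:R / 2 * moment (psi j) m.
Proof.
move=> mn; have hs : (size ('X^m : {poly R}) <= n)%N by rewrite size_polyXn.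
have := congr1 (fun q => q.[1]) (legendre_expand hs).
rewrite hornerXn expr1n horner_sum => /(congr1 (fun x => x / m`!%:R)).
rewrite mul1r mulr_suml => ->; apply: eq_bigr => j _.
by rewrite hornerZ horner1_legendre mulr1 /moment mulrA.
Qed.

Section Approx.
Variables (p : nat) (c : R).
Hypothesis hMK : mass_mx R p + esfr_mx p c \in unitmx.
Local Notation q := (@esfr_q R p c).
Local Notation f := (f_corr p c).

(** The coefficient of w^m in e^w minus the sum of the 2 q_j I_j(w). *)
Definition defect m : R := m`!%:R^-1 - \sum_(j < p.+1) q j * moment (psi j) m.

Lemma defect_sum m :
  \sum_(j < p.+1) (2 * j + 1)%:R / 2 * moment (psi j) m
    - \sum_(j < p.+1) q j * moment (psi j) m =
  (1 - f) * ((2 * p + 1)%:R / 2 * moment (psi p) m).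
Proof.
rewrite !big_ord_recr /= (esfr_q_max hMK).
have -> : \sum_(i < p) q (widen_ord (leqnSn p) i) * moment (psi i) m =
    \sum_(i < p) (2 * i + 1)%:R / 2 * moment (psi i) m.
  by apply: eq_bigr => i _; rewrite (esfr_q_lt hMK) /=.
ring.
Qed.

Lemma defect_lt m : (m < p)%N -> defect m = 0.
Proof.
move=> mp; rewrite /defect (moment_expand (ltnW mp : m < p.+1)%N) defect_sum.
by rewrite moment_legendre_lt // !mulr0.
Qed.

Lemma defect_p : defect p = (1 - f) * diag_coef p.
Proof. by rewrite /defect (moment_expand (ltnSn p)) defect_sum moment_legendre_diag. Qed.

(** The expansion of t^(p+1) reaches psi_(p+1), which the approximant lacks. The term with f drops
    out because the moment of psi_p of order p + 1 is zero by parity. *)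
Lemma defect_pS : defect p.+1 = diag_coef p.+1.
Proof.
rewrite /defect (moment_expand (ltnSn p.+1)) big_ord_recr /= addrAC defect_sum.
have := @moment_legendre_odd R p 1 isT; rewrite add1n => ->.
by rewrite !mulr0 add0r moment_legendre_diag.
Qed.

(** This is w^(p+1) times the bracket of the identity, written with exponentials only. *)
Definition residual w : R[i] :=
  w ^+ p.+1 * cexp w - \sum_(j < p.+1) (q j)%:C * exp_transform p.+1 (psi j) w.

Lemma has_pseries_residual : has_pseries (iter p.+1 (@shift_coef R) defect) residual.
Proof.
have h1 := has_pseries_mulXn p.+1 (has_pseries_cexp R).
have hW (j : 'I_p.+1) :=
  has_pseries_exp_transform (leq_trans (size_legendre_le R j) (ltn_ord j)).
have h2 := has_pseries_sum (index_enum 'I_p.+1) (fun j : 'I_p.+1 => has_pseriesZ (q j) (hW j)).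
apply: eq_has_pseries (has_pseriesD h1 (has_pseriesZ (-1) h2)) => [m|w]; last first.
  by rewrite rmorphN1 mulN1r.
rewrite !iter_shift_coefE; under eq_bigr do rewrite iter_shift_coefE.
case: ifP => _; last by rewrite mulN1r.
by rewrite big1 ?mulr0 ?addr0 // => i _; rewrite mulr0.
Qed.

Lemma exprz_subn (k : 'I_p.+1) : 2 ^ (k%:Z - p%:Z) = 2^-1 ^+ (p - k) :> R.
Proof. by rewrite -opprB subzn -1?ltnS // -exprnN exprVn. Qed.

(** Parity of psi_j turns the sign (-1)^j into (-1)^k and swaps the endpoints. P thus supplies the
    boundary terms at 1, and Q those at -1. *)
Lemma approximant_term z (j k : 'I_p.+1) x :
  ((-1) ^+ j * 2 ^ (k%:Z - p%:Z) * q j * (psi j)^`(k).[- x])%:C * z ^+ (p - k) =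
  (q j)%:C * ((-1) ^+ k * (z / 2) ^+ (p - k) * ((psi j)^`(k).[x])%:C).
Proof.
rewrite exprz_subn horner_derivn_legendre_opp exprMn_comm; last exact: mulrC.
have -> : (-1) ^+ k = ((-1) ^+ k)%:C :> R[i] by rewrite rmorphXn rmorphN1.
have -> : 2^-1 ^+ (p - k) = (2^-1 ^+ (p - k))%:C :> R[i].
  by rewrite rmorphXn fmorphV rmorph_nat.
rewrite [_ * (z ^+ _ * _)]mulrCA -!mulrA mulrCA [RHS]mulrCA [_ * z ^+ _]mulrC; congr (_ * _).
rewrite -!rmorphM; congr (_%:C); rewrite exprD.
transitivity (((-1) ^+ j) ^+ 2 * (q j * ((-1) ^+ k * 2^-1 ^+ (p - k) * (psi j)^`(k).[x]))).
  by ring.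
by rewrite sqrr_sign; ring.
Qed.

Lemma horner_P z : (P_poly p c).[z] = (z / 2) ^+ p.+1 -
  \sum_(j < p.+1) (q j)%:C *
    \sum_(k < p.+1) (-1) ^+ k * (z / 2) ^+ (p - k) * ((psi j)^`(k).[1])%:C.
Proof.
rewrite /P_poly hornerD hornerN hornerZ hornerXn mulrC exprMn_comm; last exact: mulrC.
rewrite exprVn; congr (_ - _); rewrite horner_sum; apply: eq_bigr => j _.
rewrite horner_sum mulr_sumr; apply: eq_bigr => k _.
by rewrite hornerZ hornerXn approximant_term.
Qed.

Lemma horner_Q z : (Q_poly p c).[z] = -
  \sum_(j < p.+1) (q j)%:C *
    \sum_(k < p.+1) (-1) ^+ k * (z / 2) ^+ (p - k) * ((psi j)^`(k).[-1])%:C.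
Proof.
rewrite /Q_poly hornerN; congr (- _); rewrite horner_sum; apply: eq_bigr => j _.
rewrite horner_sum mulr_sumr; apply: eq_bigr => k _.
by rewrite hornerZ hornerXn -approximant_term opprK.
Qed.

Lemma P_sub_Q_cexp z :
  (P_poly p c).[z] - (Q_poly p c).[z] * cexp (- z) =
  cexp (- (z / 2)) * residual (z / 2).
Proof.
(* One factor e^-w is pulled out in front; P recovers it by inserting e^-w e^w = 1. *)
have z2 : - z = - (z / 2) + - (z / 2) by field.
rewrite horner_P horner_Q z2 cexpD /residual; have := cexpNK (z / 2).
move: (z / 2) => w ew; rewrite mulNr opprK mulrBr [X in _ = X - _]mulrCA ew mulr1.
rewrite -addrA; congr (_ + _); rewrite mulr_sumr addrC mulr_suml -sumrB.
rewrite -sumrN; apply: eq_bigr => j _.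
rewrite /exp_transform [in RHS]mulrCA -[X in X - _]mulrA -mulrBr -mulrN; congr (_ * _).
rewrite mulr_suml mulr_sumr -sumrB -sumrN; apply: eq_bigr => k _.
rewrite -[X in _ - X]mulr1 -ew /=; ring.
Qed.

(** At z = 0 only k = p survives, and then only j = p since lower psi_j have zero p-th derivative.
    What remains is a nonzero multiple of q_p. *)
Lemma Q_neq0 : Q_poly p c != 0.
Proof.
apply/eqP => Q0; have := horner_Q 0; rewrite Q0 horner0 mul0r => /eqP.
rewrite eq_sym oppr_eq0 big_ord_recr /= big1 ?add0r => [|j _]; last first.
  rewrite big_ord_recr /= big1 ?add0r => [|k _]; last first.
    by rewrite expr0n subn_eq0 leqNgt ltn_ord mulr0 mul0r.
  rewrite derivn_small ?horner0 ?mulr0 //.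
  by rewrite (leq_trans (size_legendre_le _ _)).
rewrite big_ord_recr /= big1 ?add0r => [|k _]; last first.
  by rewrite expr0n subn_eq0 leqNgt ltn_ord mulr0 mul0r.
rewrite subnn expr0 mulr1 derivn_top ?size_legendre_le // hornerC coef_legendre.
apply/negP; rewrite !mulf_neq0 ?signr_eq0 ?fmorph_eq0 ?(esfr_q_neq0 hMK) //.
by rewrite mulf_neq0 ?lead_legendre_neq0.
Qed.

Lemma superconvergence_identity z :
  (P_poly p c).[z] - (Q_poly p c).[z] * cexp (- z) =
  (2 ^+ p.+1)^-1 * z ^+ p.+1 * cexp (- (z / 2)) *
    (cexp (z / 2) - \sum_(j < p.+1) 2 * (q j)%:C * sph_besselI j (z / 2)).
Proof.
rewrite P_sub_Q_cexp /residual.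
have -> : (2 ^+ p.+1)^-1 * z ^+ p.+1 = (z / 2) ^+ p.+1.
  by rewrite mulrC exprMn_comm ?exprVn //; exact: mulrC.
rewrite (mulrC _ (cexp (- (z / 2)))) -[RHS]mulrA; congr (_ * _); rewrite mulrBr; congr (_ - _).
rewrite mulr_sumr; apply: eq_bigr => j _.
rewrite -sph_besselIE //; last first.
  by rewrite (leq_trans (size_legendre_le _ _)).
ring.
Qed.

(** * The order of approximation at the origin *)

Lemma defect_b1 : (2 ^+ p.+1)^-1 * b1 p c = 2^-1 ^+ (2 * p + 1) * defect p.
Proof.
rewrite defect_p /b1 /diag_coef exprVn addn1 !(exprS 2) (mulnC 2 p) exprM.
have : (p * 2)`!%:R != 0 :> R by rewrite pnatr_eq0 -lt0n fact_gt0.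
have : 2 ^+ p != 0 :> R by [].
move: (2 ^+ p) ((p * 2)`!%:R) (p`!%:R) => a d e a0 d0.
by field; rewrite a0 d0.
Qed.

(** The subtracted [defect p] is the product of the leading term with the term -w of e^-w; the power
    of 1/2 converts w into z. *)
Lemma defect_b2 : (2 ^+ p.+1)^-1 * b2 p c =
  2^-1 ^+ (2 * p + 2) * (defect p.+1 - defect p).
Proof.
rewrite defect_p defect_pS /b2 /diag_coef exprVn addn2.
rewrite (_ : 2 * p.+1 = (2 * p).+2)%N ?mulnS //.
rewrite !(exprS 2) (mulnC 2 p) exprM.
have : (p * 2)`!%:R != 0 :> R by rewrite pnatr_eq0 -lt0n fact_gt0.
have : (p * 2).+2`!%:R != 0 :> R by rewrite pnatr_eq0 -lt0n fact_gt0.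
have : 2 ^+ p != 0 :> R by [].
move: (2 ^+ p) ((p * 2)`!%:R) ((p * 2).+2`!%:R) (p`!%:R) (p.+1`!%:R) => a d e g h a0 e0 d0.
by field; rewrite a0 d0 e0.
Qed.

(** The order 2p + 1 is p + 1 from the factor w^(p+1) plus p from the vanishing defects. *)
Lemma residual_expand : exists (g : R[i] -> R[i]) (K : R[i]), forall w,
  residual w = (defect p)%:C * w ^+ (2 * p + 1) + (defect p.+1)%:C * w ^+ (2 * p + 2)
    + w ^+ (2 * p + 3) * g w /\ (`|w| <= 1 -> `|g w| <= K).
Proof.
have [_ /(_ (2 * p + 3)%N)[g [K h]]] := has_pseries_residual.
exists g, K => w; have [-> gK] := h w; split => //; congr (_ + _).
have -> : (2 * p + 3 = (p.+1 + p).+2)%N by rewrite mul2n -addnn addnS addn2 addSn.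
have -> : (2 * p + 1 = p.+1 + p)%N by rewrite mul2n -addnn addn1 addSn.
have -> : (2 * p + 2 = (p.+1 + p).+1)%N by rewrite mul2n -addnn addn2 addSn.
have aN m : iter p.+1 (@shift_coef R) defect (p.+1 + m)%N = defect m.
  by rewrite iter_shift_coefE ltnNge leq_addr addKn.
have := aN p; have := aN p.+1; rewrite addnS => <- <-.
have aNlt i : (i < p.+1 + p)%N -> iter p.+1 (@shift_coef R) defect i = 0.
  move=> ip; rewrite iter_shift_coefE; case: ltnP => // pi.
  by rewrite defect_lt // ltn_subLR.
move: (iter _ _ _) (p.+1 + p)%N aNlt => a N aNlt.
rewrite !big_ord_recr big1 /= ?add0r // => i _; by rewrite aNlt ?mul0r.
Qed.

Lemma superconvergence_bound : exists2 K : R[i], 0 < K & forall z, `|z| <= 1 ->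
  `|(P_poly p c).[z] - (Q_poly p c).[z] * cexp (- z) -
    (2 ^+ p.+1)^-1 * ((b1 p c)%:C * z ^+ (2 * p + 1) + (b2 p c)%:C * z ^+ (2 * p + 2))|
  <= K * `|z ^+ (2 * p + 3)|.
Proof.
have [g1 [K1 h1]] := residual_expand.
have [_ hexp] := has_pseries_cexp R.
have [g2 [K2 h2]] := hexp 2%N.
(* The expansion of order 0 is just a bound for the exponential on the unit disc. *)
have [g0 [K0 h0]] := hexp 0%N.
have K_ge0 (g : R[i] -> R[i]) (K : R[i]) : (`|0 : R[i]| <= 1 -> `|g 0| <= K) -> 0 <= K.
  by rewrite normr0 ler01 => /(_ isT); apply: le_trans.
have K1_ge0 : 0 <= K1 by apply: (K_ge0 g1); have [] := h1 0.
have K2_ge0 : 0 <= K2 by apply: (K_ge0 g2); have [] := h2 0.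
have K0_ge0 : 0 <= K0 by apply: (K_ge0 g0); have [] := h0 0.
pose d0 : R[i] := (defect p)%:C; pose d1 : R[i] := (defect p.+1)%:C.
pose K := K2 * `|d0| + (1 + K2) * `|d1| + K0 * K1.
have K_ge : 0 <= K by rewrite !addr_ge0 ?mulr_ge0 ?addr_ge0.
(* Adding 1 makes the constant positive even if [K] is 0. *)
exists (K + 1) => [|z z1]; first by rewrite ltr_wpDl.
rewrite P_sub_Q_cexp [(2 ^+ p.+1)^-1 * (_ + _)]mulrDr ![(2 ^+ p.+1)^-1 * (_ * _)]mulrA.
have eqc (x : R) : (2 ^+ p.+1)^-1 * x%:C = ((2 ^+ p.+1)^-1 * x)%:C :> R[i].
  by rewrite rmorphM fmorphV rmorphXn rmorph_nat.
have eqh n (x : R) : (2^-1 ^+ n * x)%:C = 2^-1 ^+ n * x%:C :> R[i].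
  by rewrite rmorphM rmorphXn fmorphV rmorph_nat.
have zw n y : 2^-1 ^+ n * y * z ^+ n = y * (z / 2) ^+ n.
  rewrite [(z / 2) ^+ n]exprMn_comm; last exact: mulrC.
  by rewrite mulrAC mulrC (mulrC (z ^+ n)).
have dB : (defect p.+1 - defect p)%:C = d1 - d0 by rewrite /d0 /d1 -rmorphB.
have w1 : `|z / 2| <= `|z|.
  by rewrite normrM normfV normr_nat ler_piMr // invf_le1 // ler1n.
rewrite !eqc defect_b1 defect_b2 !eqh dB -/d0 !zw.
have w1' := le_trans w1 z1; move: (z / 2) w1 w1' => w wz w1 {zw}.
have wN1 : `|- w| <= 1 by rewrite normrN.
have [e1 /(_ w1) l1] := h1 w; have [e2 /(_ wN1) l2] := h2 (- w).
have [e0 /(_ wN1) l0] := h0 (- w).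
have nE k : (2 * p + k.+1 = (2 * p + k).+1)%N by rewrite addnS.
(* Expanding e^-w to second order against d0 and d1 cancels the two leading powers. The term in g1
   keeps e^-w whole, which needs only the bound [K0]. *)
rewrite (_ : _ - _ = w ^+ (2 * p + 3) *
    (g2 (- w) * d0 + (w * g2 (- w) - 1) * d1 + cexp (- w) * g1 w)); last first.
  have {}e2 : cexp (- w) = 1 - w + w ^+ 2 * g2 (- w).
    rewrite e2 !big_ord_recr big_ord0 /= add0r expr0 expr1 sqrrN !fact0 invr1 mulr1.
    by rewrite mul1r.
  rewrite e1 -/d0 -/d1 !nE addn0 !exprS mulrDr {1}e2.
  by move: (w ^+ (2 * p)) (cexp _) (g2 _) (g1 _) => W C G2 G1; ring.
rewrite normrM mulrC !normrX; apply: ler_pM => //.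
  rewrite (@le_trans _ _ K) ?lerDl // /K.
  rewrite (le_trans (ler_normD _ _)) // lerD //; last first.
    by rewrite normrM ler_pM // e0 big_ord0 add0r expr0 mul1r.
  rewrite (le_trans (ler_normD _ _)) // lerD //; rewrite normrM ler_wpM2r //.
  rewrite (le_trans (ler_normB _ _)) // normr1 addrC lerD2l normrM.
  by rewrite -[leRHS]mul1r ler_pM.
by rewrite lerXn2r.
Qed.

Lemma superconvergence_order :
  (fun z : R[i]^o => (P_poly p c).[z] - (Q_poly p c).[z] * cexp (- z) : R[i]^o) =
  (fun z : R[i]^o => (2 ^+ p.+1)^-1 * ((b1 p c)%:C * z ^+ (2 * p + 1)
                             + (b2 p c)%:C * z ^+ (2 * p + 2)) : R[i]^o)
  +O_ (0 : R[i]^o) (fun z : R[i]^o => z ^+ (2 * p + 3) : R[i]^o).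
Proof.
have [K K0 hK] := superconvergence_bound.
apply/eqaddOP; apply/bigO_exP; exists K => //; near=> z; apply: hK.
near: z.
exact: (@nbhs0_le R[i] R[i]^o 1 ltr01).
Unshelve. all: by end_near.
Qed.

End Approx.
End Final.

Theorem lemma3p4 (R : realType) (p : nat) (c : R)
    (hMK : mass_mx R p + esfr_mx p c \in unitmx) :
  [/\ Q_poly p c != 0,
      forall z : R[i],
        (P_poly p c).[z] - (Q_poly p c).[z] * cexp (- z) =
        (2 ^+ p.+1)^-1 * z ^+ p.+1 * cexp (- (z / 2)) *
          (cexp (z / 2) -
             \sum_(j < p.+1) 2 * (esfr_q c j)%:C * sph_besselI j (z / 2))
    & (fun z : R[i]^o =>
         (P_poly p c).[z] - (Q_poly p c).[z] * cexp (- z) : R[i]^o) =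
      (fun z : R[i]^o =>
         (2 ^+ p.+1)^-1 * ((b1 p c)%:C * z ^+ (2 * p + 1)
                             + (b2 p c)%:C * z ^+ (2 * p + 2)) : R[i]^o)
      +O_ (0 : R[i]^o) (fun z : R[i]^o => z ^+ (2 * p + 3) : R[i]^o)].
Proof.
split; first exact: Q_neq0.
- exact: superconvergence_identity.
- exact: superconvergence_order.
Qed.
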